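(* Every knot-like complex is locally equivalent to a standard complex.
   Context: Conventions: $\mathbb{F}=\mathbb{Z}/2\mathbb{Z}$. Let $\mathcal{R}=\mathbb{F}[U,V]/(UV)$, with bigrading $\mathrm{gr}=(\mathrm{gr}_U,\mathrm{gr}_V)$, $\mathrm{gr}(U)=(-2,0)$, $\mathrm{gr}(V)=(0,-2)$. Knot-like complexes. A knot-like complex $C$ is a free, finitely generated, bigraded chain complex over $\mathcal{R}$, with differential of degree $(-1,-1)$, such that (1) $H_*(C/U)/V\text{-torsion}\cong\mathbb{F}[V]$ and all $V$-nontorsion classes in $H_*(C/U)$ have $\mathrm{gr}_U=0$; (2) $H_*(C/V)/U\text{-torsion}\cong\mathbb{F}[U]$ and all $U$-nontorsion classes in $H_*(C/V)$ have $\mathrm{gr}_V=0$. Write $C_1\le C_2$ if there is a local map $f\colon C_1\to C_2$, i.e. an $\mathcal{R}$-equivariant chain map that preserves $\mathrm{gr}_U$, shifts $\mathrm{gr}_V$ by a constant, and induces an isomorphism $H_*(C_1/U)/V\text{-torsion}\to H_*(C_2/U)/V\text{-torsion}$. $C_1$ and $C_2$ are locally equivalent, $C_1\sim C_2$, if $C_1\le C_2$ and $C_2\le C_1$. Standard complexes. For $n\ge 0$ even and nonzero integers $b_1,\dots,b_n$, the standard complex $C(b_1,\dots,b_n)$ is freely generated over $\mathcal{R}$ by $x_0,\dots,x_n$ with $\partial=\partial_U+\partial_V$, where for $i$ odd: $\partial_U x_{i-1}=U^{|b_i|}x_i$ if $b_i<0$, and $\partial_U x_i=U^{b_i}x_{i-1}$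 if $b_i>0$; for $i$ even: $\partial_V x_{i-1}=V^{|b_i|}x_i$ if $b_i<0$, and $\partial_V x_i=V^{b_i}x_{i-1}$ if $b_i>0$; all other $\partial_U,\partial_V$ of generators vanish. The bigrading is the unique one with $\mathrm{gr}_U(x_0)=0$, $\mathrm{gr}_V(x_n)=0$ and $\partial$ of degree $(-1,-1)$. For $n=0$ this is the trivial complex $C(0)=\mathcal{R}$. *)

(* Defs.v *)
From HB Require Import structures.
From mathcomp Require Import all_boot all_order all_algebra.
From mathcomp Require Import ring boolp.
From mathcomp.multinomials Require Import mpoly.

Set Implicit Arguments.
Unset Strict Implicit.
Unset Printing Implicit Defensive.

Import Order.TTheory GRing.Theory Num.Theory.
Local Open Scope ring_scope.
Local Open Scope quotient_scope.

(* A [submodClosed] predicate is closed under opposites because [K] is a ring, but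
   the library does not register it as [zmodClosed]; hence this copy of [S]. *)
Definition submod_pred (K : pzRingType) (V : lmodType K) (S : submodClosed V) :
  {pred V} := S.

Section QuotientModule.
Variables (K : pzRingType) (V : lmodType K) (S : submodClosed V).

Fact submod_pred_closed : zmod_closed (submod_pred S).
Proof. exact: GRing.submod_closedB (GRing.submodClosedP S). Qed.

HB.instance Definition _ :=
  GRing.isZmodClosed.Build V (submod_pred S) submod_pred_closed.

Definition quotm : Type := Quotient.quot (submod_pred S).

HB.instance Definition _ := GRing.Zmodule.on quotm.

Definition pim (x : V) : quotm := \pi_(Quotient.quot (submod_pred S)) x.
Definition reprm (q : quotm) : V := repr (q : Quotient.quot (submod_pred S)).

Lemma reprmK : cancel reprm pim.
Proof. exact: reprK. Qed.

Lemma pim_eqP (x y : V) : reflect (pim x = pim y) (x - y \in S).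
Proof. by rewrite (Quotient.idealrBE (submod_pred S)); exact: eqP. Qed.

Fact pim_zmod_morphism : zmod_morphism pim.
Proof. exact: pi_is_zmod_morphism. Qed.

HB.instance Definition _ :=
  GRing.isZmodMorphism.Build V quotm pim pim_zmod_morphism.

Definition qscale (a : K) (x : quotm) : quotm := pim (a *: reprm x).

Lemma pi_scale a x : qscale a (pim x) = pim (a *: x).
Proof. by apply/pim_eqP; rewrite -scalerBr rpredZ //; apply/pim_eqP/reprmK. Qed.

Fact qscalerA a b x : qscale a (qscale b x) = qscale (a * b) x.
Proof. by rewrite -[x]reprmK !pi_scale scalerA. Qed.

Fact qscale1r : left_id 1 qscale.
Proof. by move=> x; rewrite -[x]reprmK pi_scale scale1r. Qed.

Fact qscalerDr : right_distributive qscale +%R.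
Proof.
move=> a x y; rewrite -[x]reprmK -[y]reprmK -raddfD !pi_scale.
by rewrite scalerDr raddfD.
Qed.

Fact qscalerDl x : {morph qscale^~ x : a b / a + b}.
Proof. by move=> a b; rewrite -[x]reprmK !pi_scale scalerDl raddfD. Qed.

HB.instance Definition _ := GRing.Zmodule_isLmodule.Build K quotm
  qscalerA qscale1r qscalerDr qscalerDl.

Fact pim_scalable : scalable pim.
Proof. by move=> a x; rewrite -pi_scale. Qed.

HB.instance Definition _ := GRing.isScalable.Build K V quotm _ pim pim_scalable.

End QuotientModule.

Section QuotientMap.
Variables (K : pzRingType) (V W : lmodType K).
Variables (S : submodClosed V) (T : submodClosed W) (f : {linear V -> W}).

Definition quot_map (_ : forall x, x \in S -> f x \in T) (q : quotm S) : quotm T :=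
  pim T (f (reprm q)).

Hypothesis fST : forall x, x \in S -> f x \in T.

Lemma quot_mapE x : quot_map fST (pim S x) = pim T (f x).
Proof.
by apply/pim_eqP; rewrite -linearB; apply: fST; apply/pim_eqP/reprmK.
Qed.

Fact quot_map_linear : linear (quot_map fST).
Proof.
move=> a x y; rewrite -[x]reprmK -[y]reprmK -linearP !quot_mapE.
by rewrite !linearP.
Qed.

HB.instance Definition _ := GRing.isLinear.Build K (quotm S) (quotm T) _
  (quot_map fST) quot_map_linear.

End QuotientMap.

Section ModScalar.
Variables (K : comNzRingType) (r : K).

Definition mults (V : lmodType K) : {pred V} :=
  fun x => `[< exists y, x = r *: y >].
Arguments mults V x : clear implicits.

Lemma multsP (V : lmodType K) (x : V) : reflect (exists y, x = r *: y) (x \in mults V).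
Proof. exact: asboolP. Qed.

Fact mults_closed (V : lmodType K) : submod_closed (mults V).
Proof.
split; first by apply/multsP; exists 0; rewrite scaler0.
move=> a x y /multsP[x' ->] /multsP[y' ->]; apply/multsP.
by exists (a *: x' + y'); rewrite scalerDr !scalerA mulrC.
Qed.

HB.instance Definition _ (V : lmodType K) :=
  GRing.isSubmodClosed.Build K V (mults V) (mults_closed V).

Definition modr (V : lmodType K) : lmodType K := quotm (mults V).

Fact mults_map (V W : lmodType K) (f : {linear V -> W}) x :
  x \in mults V -> f x \in mults W.
Proof.
by case/multsP=> y ->; apply/multsP; exists (f y); rewrite linearZ.
Qed.

Definition modr_map (V W : lmodType K) (f : {linear V -> W}) :
  {linear modr V -> modr W} := quot_map (@mults_map V W f).

Lemma modr_mapE (V W : lmodType K) (f : {linear V -> W}) x :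
  modr_map f (pim (mults V) x) = pim (mults W) (f x).
Proof. exact: quot_mapE. Qed.

End ModScalar.

Arguments mults {K} r V x.

Section Torsion.
Variables (K : comNzRingType) (s : K).

(* Torsion means killed by a power of the variable [s]. *)
Definition torsion (V : lmodType K) : {pred V} :=
  fun x => `[< exists n, s ^+ n *: x = 0 >].
Arguments torsion V x : clear implicits.

Lemma torsionP (V : lmodType K) (x : V) :
  reflect (exists n, s ^+ n *: x = 0) (x \in torsion V).
Proof. exact: asboolP. Qed.

Fact torsion_closed (V : lmodType K) : submod_closed (torsion V).
Proof.
split; first by apply/torsionP; exists 0%N; rewrite scaler0.
move=> a x y /torsionP[m sx] /torsionP[n sy]; apply/torsionP.
exists (m + n)%N; rewrite scalerDr scalerA mulrC -scalerA.
rewrite {1}addnC !exprD -!scalerA sx sy.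
by rewrite !scaler0 addr0.
Qed.

HB.instance Definition _ (V : lmodType K) :=
  GRing.isSubmodClosed.Build K V (torsion V) (torsion_closed V).

Definition mod_torsion (V : lmodType K) : lmodType K := quotm (torsion V).

Fact torsion_map (V W : lmodType K) (f : {linear V -> W}) x :
  x \in torsion V -> f x \in torsion W.
Proof.
by case/torsionP=> n sx; apply/torsionP; exists n; rewrite -linearZ sx linear0.
Qed.

Definition mod_torsion_map (V W : lmodType K) (f : {linear V -> W}) :
  {linear mod_torsion V -> mod_torsion W} := quot_map (@torsion_map V W f).

Lemma mod_torsion_mapE (V W : lmodType K) (f : {linear V -> W}) x :
  mod_torsion_map f (pim (torsion V) x) = pim (torsion W) (f x).
Proof. exact: quot_mapE. Qed.

End Torsion.

Arguments torsion {K} s V x.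

Section Homology.
Variables (K : pzRingType) (V : lmodType K) (d : {linear V -> V}).

(* [homology] makes sense for any endomorphism [d]; the condition [d \o d = 0] is
   carried by the complexes below. *)
Definition is_cycle : {pred V} := fun x => d x == 0.

Fact is_cycle_closed : submod_closed is_cycle.
Proof.
split=> [|a x y]; rewrite !unfold_in ?linear0 // linearP.
by move=> /eqP-> /eqP->; rewrite scaler0 addr0.
Qed.

HB.instance Definition _ :=
  GRing.isSubmodClosed.Build K V is_cycle is_cycle_closed.

Record cycle := Cycle { cycle_val :> V; _ : cycle_val \in is_cycle }.

HB.instance Definition _ := [isSub for cycle_val].
HB.instance Definition _ := [Choice of cycle by <:].
HB.instance Definition _ := [SubChoice_isSubLmodule of cycle by <:].

Definition is_boundary : {pred cycle} :=
  fun z => `[< exists y, cycle_val z = d y >].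

Lemma is_boundaryP (z : cycle) :
  reflect (exists y, cycle_val z = d y) (z \in is_boundary).
Proof. exact: asboolP. Qed.

Fact is_boundary_closed : submod_closed is_boundary.
Proof.
split; first by apply/is_boundaryP; exists 0; rewrite linear0.
move=> a x y /is_boundaryP[x' xE] /is_boundaryP[y' yE]; apply/is_boundaryP.
by exists (a *: x' + y'); rewrite linearP -xE -yE.
Qed.

HB.instance Definition _ :=
  GRing.isSubmodClosed.Build K cycle is_boundary is_boundary_closed.

Definition homology : lmodType K := quotm is_boundary.

End Homology.

Arguments is_boundary {K V} d z.

Section HomologyMap.
Variables (K : pzRingType) (V W : lmodType K).
Variables (dV : {linear V -> V}) (dW : {linear W -> W}) (f : {linear V -> W}).
Hypothesis fd : forall x, f (dV x) = dW (f x).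

Fact cycle_map_subproof (z : cycle dV) : f (cycle_val z) \in is_cycle dW.
Proof.
case: z => z zP /=; rewrite unfold_in -fd.
by move: zP; rewrite unfold_in => /eqP->; rewrite linear0.
Qed.

Definition cycle_map (z : cycle dV) : cycle dW := Cycle (cycle_map_subproof z).

Fact cycle_map_linear : linear cycle_map.
Proof. by move=> a x y; apply: val_inj; rewrite /= linearP. Qed.

HB.instance Definition _ :=
  GRing.isLinear.Build K (cycle dV) (cycle dW) _ cycle_map cycle_map_linear.

Fact boundary_map z : z \in is_boundary dV -> cycle_map z \in is_boundary dW.
Proof.
by case/is_boundaryP=> y zE; apply/is_boundaryP; exists (f y); rewrite /= zE fd.
Qed.

Definition homology_map : {linear homology dV -> homology dW} :=
  quot_map boundary_map.

Lemma homology_mapE (z : cycle dV) :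
  homology_map (pim (is_boundary dV) z) = pim (is_boundary dW) (cycle_map z).
Proof. exact: quot_mapE. Qed.

End HomologyMap.

Definition FUV : comNzRingType := {mpoly 'F_2[2]}.

Definition UVideal : {pred FUV} :=
  fun p => `[< exists q : FUV, p = q * ('X_0 * 'X_1) >].

Fact UVideal_closed : idealr_closed UVideal.
Proof.
split.
- by apply/asboolP; exists 0; rewrite mul0r.
- apply/asboolP => -[q /(congr1 (meval (fun=> 0)))].
  by rewrite meval1 !mevalM !mevalXU !mulr0 => /eqP; rewrite oner_eq0.
- move=> a p q /asboolP[p' ->] /asboolP[q' ->]; apply/asboolP.
  by exists (a * p' + q'); rewrite mulrDl mulrA.
Qed.

HB.instance Definition _ := isIdealr.Build FUV UVideal UVideal_closed.

Definition RUV : comNzRingType := {ideal_quot UVideal}.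

Definition U : RUV := \pi_{ideal_quot UVideal} 'X_0.
Definition V : RUV := \pi_{ideal_quot UVideal} 'X_1.

Lemma UV0 : U * V = 0.
Proof.
rewrite /U /V -rmorphM -[RHS](rmorph0 (\pi_{ideal_quot UVideal})).
by apply/eqP; rewrite -Quotient.idealrBE subr0; apply/asboolP; exists 1;
  rewrite mul1r.
Qed.

Notation bideg := (int * int)%type.

(* The degree [e] part of [RUV] is [{0, U^i V^j}] when [e = (-2i, -2j)], because
   the coefficients are in the field with two elements; otherwise it is [0]. *)
Definition homogR (e : bideg) (r : RUV) : Prop :=
  r = 0 \/ exists i j : nat,
    e = (- (2 * i)%:Z, - (2 * j)%:Z) /\ r = U ^+ i * V ^+ j.

(* [homogeneous gr e x] : the element [x] of the free module whose [i]-th generator has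
   bidegree [gr i] is homogeneous of bidegree [e]. *)
Definition homogeneous n (gr : 'I_n -> bideg) (e : bideg) (x : 'rV[RUV]_n) : Prop :=
  forall i, homogR (e - gr i) (x 0 i).

Fact homogRM e e' r r' : homogR e r -> homogR e' r' -> homogR (e + e') (r * r').
Proof.
case=> [->|[i [j [-> ->]]]]; first by left; rewrite mul0r.
case=> [->|[k [l [-> ->]]]]; first by left; rewrite mulr0.
right; exists (i + k)%N, (j + l)%N; split; last by rewrite !exprD mulrACA.
by congr (_, _) => /=; rewrite mulnDr PoszD opprD.
Qed.

Fact RUV_pchar2 (r : RUV) : r + r = 0.
Proof.
suff -> : r + r = r * \pi_{ideal_quot UVideal} (2%:R : FUV).
  have -> : (2%:R : FUV) = 0.
    by rewrite -[2%:R](rmorph_nat (@mpolyC 2 'F_2)) pchar_Fp_0 // mpolyC0.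
  by rewrite [X in _ * X]rmorph0 mulr0.
by rewrite [X in _ * X]rmorph_nat mulr_natr mulr2n.
Qed.

Fact homogRD e r r' : homogR e r -> homogR e r' -> homogR e (r + r').
Proof.
case=> [->|[i [j [-> ->]]]]; first by rewrite add0r.
case=> [->|[k [l [[/eqP ik /eqP jl] ->]]]].
  by rewrite addr0; right; exists i, j.
have {ik} -> : k = i.
  by move: ik; rewrite eqr_opp eqz_nat eqn_pmul2l // => /eqP.
have {jl} -> : l = j.
  by move: jl; rewrite eqr_opp eqz_nat eqn_pmul2l // => /eqP.
by left; apply: RUV_pchar2.
Qed.

Fact homogeneous_mulmx m n (g : 'I_m -> bideg) (h : 'I_n -> bideg) c
    (A : 'M[RUV]_(m, n)) :
    (forall i j, homogR (c + g i - h j) (A i j)) ->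
  forall e x, homogeneous g e x -> homogeneous h (e + c) (x *m A).
Proof.
move=> Ag e x xe j; rewrite mxE; elim/big_ind: _ => [|r r' | i _].
- by left.
- exact: homogRD.
have -> : e + c - h j = e - g i + (c + g i - h j).
  by rewrite addrA [c + g i]addrC [e - g i + _]addrA subrK.
exact: homogRM (xe i) (Ag i j).
Qed.

(* A free bigraded complex is given on a basis of homogeneous generators; a degree
   condition is vacuous at [0], which is homogeneous of every bidegree. *)
Record bicomplex := Bicomplex {
  rank : nat;
  gr : 'I_rank -> bideg;
  diff : {linear 'rV[RUV]_rank -> 'rV[RUV]_rank};
  diff_sq : forall x, diff (diff x) = 0;
  diff_deg : forall e x, homogeneous gr e x -> homogeneous gr (e - (1, 1)) (diff x) }.

Definition Hmod (r : RUV) (C : bicomplex) : lmodType RUV :=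
  homology (modr_map r (diff C)).

(* [H_*(C/r) / s-torsion] *)
Definition Htf (r s : RUV) (C : bicomplex) : lmodType RUV :=
  mod_torsion s (Hmod r C).

(* A homology class of [C/r] has bidegree [e] when it is represented by a cycle that
   is the reduction of an element of [C] homogeneous of bidegree [e]. *)
Definition homogeneous_class (r : RUV) (C : bicomplex) (e : bideg) (h : Hmod r C) :=
  exists (x : 'rV[RUV]_(rank C)) (z : cycle (modr_map r (diff C))),
    [/\ homogeneous (@gr C) e x, cycle_val z = pim (mults r 'rV_(rank C)) x
      & h = pim (is_boundary (modr_map r (diff C))) z].

(* [M] is isomorphic to the polynomial ring in [s] over the field with two
   elements, as a module over this ring; additive maps are automatically linear
   over that field. *)
Definition iso_poly (s : RUV) (M : lmodType RUV) : Prop :=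
  exists f : {additive M -> {poly 'F_2}},
    bijective f /\ forall h, f (s *: h) = 'X * f h.

Definition knot_like (C : bicomplex) : Prop :=
  [/\ iso_poly V (Htf U V C),
      forall e (h : Hmod U C),
        homogeneous_class e h -> h \notin torsion V (Hmod U C) -> e.1 = 0,
      iso_poly U (Htf V U C)
    & forall e (h : Hmod V C),
        homogeneous_class e h -> h \notin torsion U (Hmod V C) -> e.2 = 0].

Record chain_map (C D : bicomplex) := ChainMap {
  chain_fun :> {linear 'rV[RUV]_(rank C) -> 'rV[RUV]_(rank D)};
  chain_mapP : forall x, chain_fun (diff C x) = diff D (chain_fun x) }.

Section InducedMap.
Variables (r s : RUV) (C D : bicomplex) (f : chain_map C D).

Fact modr_chain_mapP (x : modr r 'rV[RUV]_(rank C)) :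
  modr_map r f (modr_map r (diff C) x) = modr_map r (diff D) (modr_map r f x).
Proof. by rewrite -[x]reprmK !modr_mapE chain_mapP. Qed.

Definition Htf_map : {linear Htf r s C -> Htf r s D} :=
  mod_torsion_map s (homology_map modr_chain_mapP).

End InducedMap.

Definition local_map (C D : bicomplex) (f : chain_map C D) : Prop :=
  (exists c : int, forall e x,
     homogeneous (@gr C) e x -> homogeneous (@gr D) (e + (0, c)) (f x))
  /\ bijective (Htf_map U V f).

Definition local_le (C D : bicomplex) : Prop :=
  exists f : chain_map C D, local_map f.

Definition local_equiv (C D : bicomplex) : Prop :=
  local_le C D /\ local_le D C.

Section Standard.
Variable b : seq int.
Local Notation n := (size b).

(* The parameters are numbered from 1 and the generators from 0. *)
Definition sparam (k : nat) : int := nth 0 b k.-1.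

Definition svar (k : nat) : RUV := if odd k then U else V.

(* The entry at [(i, j)] is the coefficient of [x_j] in the differential of [x_i]. *)
Definition std_mx : 'M[RUV]_n.+1 :=
  \matrix_(i, j)
    if (j == i.+1 :> nat) && (sparam j < 0) then svar j ^+ `|sparam j|%N
    else if (i == j.+1 :> nat) && (0 < sparam i) then svar i ^+ `|sparam i|%N
    else 0.

Definition std_diff : {linear 'rV[RUV]_n.+1 -> 'rV[RUV]_n.+1} := mulmxr std_mx.

(* The bidegree of [x_k] minus that of [x_(k-1)], forced by the differential
   having degree [(-1,-1)]. *)
Definition std_step (k : nat) : bideg :=
  (sgz (sparam k), sgz (sparam k))
  - (if odd k then (2 * sparam k, 0) else (0, 2 * sparam k)).

Definition std_gr (i : 'I_n.+1) : bideg :=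
  (\sum_(1 <= k < i.+1) (std_step k).1, - \sum_(i.+1 <= k < n.+1) (std_step k).2).

Lemma std_gr0 : (std_gr ord0).1 = 0.
Proof. by rewrite /= big_geq. Qed.

Lemma std_gr_max : (std_gr ord_max).2 = 0.
Proof. by rewrite /= big_geq ?oppr0. Qed.

Lemma std_grS (i j : 'I_n.+1) : j = i.+1 :> nat ->
  std_gr j - std_gr i = std_step j.
Proof.
move=> ji; rewrite /std_gr [RHS]surjective_pairing ji; congr (_, _) => /=.
  by rewrite [X in X - _]big_nat_recr //= addrAC subrr add0r.
have ij : (i.+1 < n.+1)%N by rewrite -ji.
by rewrite [X in _ - - X]big_ltn // opprK addrCA addNr addr0.
Qed.

Fact svar_mul0 k p q : svar k ^+ p.+1 * svar k.+1 ^+ q.+1 = 0.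
Proof.
rewrite exprSr exprS -mulrA (mulrA (svar k)).
suff -> : svar k * svar k.+1 = 0 by rewrite mul0r mulr0.
by rewrite /svar /=; case: (odd k); rewrite ?[V * U]mulrC UV0.
Qed.

Fact std_mx_sq : std_mx *m std_mx = 0.
Proof.
apply/matrixP=> i k; rewrite !mxE big1 // => j _; rewrite !mxE.
have pw (x : int) : x != 0 -> exists p, `|x|%N = p.+1.
  by rewrite -absz_eq0; case: `|x|%N => // p _; exists p.
case: ifP => [/andP[/eqP ji bj]|_].
  case: ifP => [/andP[/eqP kj bk]|_].
    have [p ->] := pw _ (ltr0_neq0 bj); have [q ->] := pw _ (ltr0_neq0 bk).
    by rewrite kj svar_mul0.
  case: ifP => [/andP[_ bj']|_]; last by rewrite mulr0.
  by have := lt_trans bj bj'; rewrite ltxx.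
case: ifP => [/andP[/eqP ij bi]|_]; last by rewrite mul0r.
case: ifP => [/andP[/eqP kj bk]|_].
  by move: bk; rewrite kj -ij => bk; have := lt_trans bi bk; rewrite ltxx.
case: ifP => [/andP[/eqP jk bj]|_]; last by rewrite mulr0.
have [p ->] := pw _ (lt0r_neq0 bi); have [q ->] := pw _ (lt0r_neq0 bj).
by rewrite ij mulrC svar_mul0.
Qed.

Fact std_diff_sq x : std_diff (std_diff x) = 0.
Proof. by rewrite /= -mulmxA std_mx_sq mulmx0. Qed.

Fact svar_deg k p :
  homogR (if odd k then (- (2 * p)%:Z, 0) else (0, - (2 * p)%:Z)) (svar k ^+ p).
Proof.
rewrite /svar; case: (odd k); right; [exists p, 0%N | exists 0%N, p].
  by rewrite muln0 oppr0 mulr1.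
by rewrite muln0 oppr0 mul1r.
Qed.

Fact std_mx_deg i j : homogR (- (1, 1) + std_gr i - std_gr j) (std_mx i j).
Proof.
rewrite mxE -addrA; case: ifP => [/andP[/eqP ji bj]|_].
  have -> : - (1, 1) + (std_gr i - std_gr j) = 
      if odd j then (- (2 * `|sparam j|)%:Z, 0) else (0, - (2 * `|sparam j|)%:Z).
    rewrite -opprB (std_grS ji) /std_step ltr0_sgz // PoszM ltz0_abs //.
    by case: (odd j); congr (_, _) => /=; ring.
  exact: svar_deg.
case: ifP => [/andP[/eqP ij bi]|_]; last by left.
have -> : - (1, 1) + (std_gr i - std_gr j) = 
    if odd i then (- (2 * `|sparam i|)%:Z, 0) else (0, - (2 * `|sparam i|)%:Z).
  rewrite (std_grS ij) /std_step gtr0_sgz // PoszM gtz0_abs //.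
  by case: (odd i); congr (_, _) => /=; ring.
exact: svar_deg.
Qed.

Fact std_diff_deg e x :
  homogeneous std_gr e x -> homogeneous std_gr (e - (1, 1)) (std_diff x).
Proof. exact: homogeneous_mulmx std_mx_deg e x. Qed.

Definition standard_complex : bicomplex := Bicomplex std_diff_sq std_diff_deg.

End Standard.

(* Main.v *)
(* Setting one of [U], [V] to 1 and the other to 0 turns a complex C over [RUV] into two
   complexes over the field with two elements, glued along generators of equal bidegree.
   The letter -k (resp. k) of a side relates x to y when x lifts to a chain whose
   differential is the k-th power of the variable times a lift of y (resp. the other way
   round).  Start from the set of generators of the V-tower and, alternately on the two
   sides, choose the least letter in the order 1 < 2 < .. < 0 < .. < -2 < -1 that starts
   somewhere in the current set, and move to the set of all elements reached.  The choice
   of 0 stops the walk; the letters b_1, .., b_n before it form the standard complex S.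

   By linear duality, the fact that no walk with these letters ends in the torsion part
   gives a walk with opposite letters in the dual complex.  The walk in C is a local map
   from S to C, the transpose of the dual walk is a local map from C to S.

   The process stops: the same duality gives functionals f_i with f_i (x_i) = 1 along any
   walk, and x_i = x_j with i < j would give, going left from both positions, equal
   letters all the way to x_0, where the tower has the letter 0 and x_(j - i) has not; so
   the x_i are distinct vectors of a finite space.  It stops after an even number of
   letters, because the nontorsion V-cycles have gr_U = 0 and each letter changes the
   parity of gr_U. *)

Require Import Defs.
From HB Require Import structures.
From mathcomp Require Import all_boot all_order all_algebra.
From mathcomp Require Import ring zify boolp.
From mathcomp.multinomials Require Import mpoly.

Set Implicit Arguments.
Unset Strict Implicit.
Unset Printing Implicit Defensive.

Import Order.TTheory GRing.Theory Num.Theory.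
Local Open Scope ring_scope.
Local Open Scope quotient_scope.

(** * Linear algebra over the two-element field *)

Section Fredholm.

Lemma F2_cases (a : 'F_2) : a = 0 \/ a = 1.
Proof. by case: a => [[|[|//]] lt_a]; [left | right]; apply: val_inj. Qed.

Lemma F2_neq0 (a : 'F_2) : a != 0 -> a = 1.
Proof. by case: (F2_cases a) => -> //; rewrite eqxx. Qed.

Definition additive_pred m (P : 'rV['F_2]_m -> Prop) :=
  P 0 /\ forall x y, P x -> P y -> P (x + y).

Lemma additive_pred_scale m (P : 'rV['F_2]_m -> Prop) a x :
  additive_pred P -> P x -> P (a *: x).
Proof. by case=> P0 _; case: (F2_cases a) => ->; rewrite ?scale0r ?scale1r. Qed.

Lemma rV2_oppr m n (x : 'M['F_2]_(m, n)) : - x = x.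
Proof.
apply/matrixP=> i j; rewrite mxE.
by case: (F2_cases (x i j)) => ->; apply: val_inj.
Qed.

Lemma additive_predB m (P : 'rV['F_2]_m -> Prop) x y :
  additive_pred P -> P x -> P y -> P (x - y).
Proof. by case=> _ PD Px Py; rewrite rV2_oppr; apply: PD. Qed.

(** The ambient space is finite, so the members of [P] can themselves serve as a spanning family;
    closure under scaling is automatic over two elements. *)
Lemma additive_pred_mx m (P : 'rV['F_2]_m -> Prop) : additive_pred P ->
  exists M : 'M['F_2]_m, forall x, P x <-> (x <= M)%MS.
Proof.
move=> addP; have [P0 PD] := addP.
exists (\sum_(x : 'rV['F_2]_m | `[< P x >]) <<x>>)%MS => x; split=> [Px|].
  by rewrite (sumsmx_sup x) ?genmxE //; apply/asboolP.
case/sub_sumsmxP=> u ->; elim/big_ind: _ => // y /asboolP Py.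
have /submxP[a ->] : (u y *m <<y>> <= y)%MS.
  by rewrite (submx_trans (submxMl _ _)) ?genmxE.
by rewrite (mx11_scalar a) mul_scalar_mx; apply: additive_pred_scale.
Qed.

Lemma additive_pred_sep m (P : 'rV['F_2]_m -> Prop) t : additive_pred P ->
  ~ P t -> exists f : 'rV_m, (forall x, P x -> x *m f^T = 0) /\ t *m f^T = 1%:M.
Proof.
move=> /additive_pred_mx[M PM] /PM/negP; rewrite submxE => /rV0Pn[j tj].
exists (col j (cokermx M))^T; rewrite trmxK; split=> [x /PM|].
  by rewrite submxE => /eqP xM; rewrite colE mulmxA xM mul0mx.
apply/matrixP=> i k; rewrite !ord1 !mxE.
move/F2_neq0: tj; rewrite mxE => <-.
by apply: eq_bigr => l _; rewrite mxE.
Qed.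

(* The functional on [phi] of the elements of [Q] that is induced by [f] extends to
   all vectors, because [f] vanishes on the elements of [Q] mapped into [B]. *)
Lemma fredholm a b (Q : 'rV['F_2]_a -> Prop) (B : 'rV['F_2]_b -> Prop)
    (phi : 'M_(a, b)) (f : 'cV_a) :
    additive_pred Q -> additive_pred B ->
    (forall z, Q z -> B (z *m phi) -> z *m f = 0) ->
  exists g : 'cV_b, (forall y, B y -> y *m g = 0) /\
    forall z, Q z -> z *m f = z *m phi *m g.
Proof.
move=> /additive_pred_mx[M QM] /additive_pred_mx[N BN] f0.
set psi := M *m phi *m cokermx N.
(* [psi] is [phi] on the row space of [M], taken modulo [B]. As [M *m f] vanishes on its kernel, it
   factors through [psi]. *)
have ker_f : kermx psi *m (M *m f) = 0.
  apply/row_matrixP=> i; rewrite row_mul row0 mulmxA.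
  apply: f0; first by apply/QM/submxMl.
  apply/BN; rewrite submxE -!mulmxA (mulmxA M) -/psi -row_mul mulmx_ker.
  by rewrite row0.
have Mf : M *m f = psi *m (pinvmx psi *m (M *m f)).
  apply/eqP; rewrite -subr_eq0 mulmxA -{1}[M *m f]mul1mx -mulmxBl.
  have /submxP[h ->] : (1%:M - psi *m pinvmx psi <= kermx psi)%MS.
    by apply/sub_kermxP; rewrite mulmxBl mul1mx mulmxKpV ?subrr.
  by rewrite -mulmxA ker_f mulmx0.
exists (cokermx N *m (pinvmx psi *m (M *m f))); split=> [y /BN|z /QM].
  by rewrite submxE => /eqP yN; rewrite (mulmxA y (cokermx N)) yN mul0mx.
case/submxP=> u ->; rewrite -!mulmxA [in LHS]Mf /psi.
by rewrite !mulmxA.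
Qed.

End Fredholm.

(** * Bigraded complexes over the two-element field *)

Lemma bidegE (d d' : bideg) : d = d' <-> d.1 = d'.1 /\ d.2 = d'.2.
Proof. by case: d d' => a b [c d] /=; split=> [[-> ->]|[-> ->]]. Qed.

(* [- sh s k] is the bidegree of the [k]-th power of the variable of side [s], where
   [true] is the side of [U] and [false] the side of [V]. *)
Definition sh (s : bool) (k : int) : bideg := if s then (2 * k, 0) else (0, 2 * k).

(** This is [std_step] with the side and the letter as arguments. *)
Definition step_deg (s : bool) (c : int) : bideg := (sgz c, sgz c) - sh s c.

Lemma fstD (d d' : bideg) : (d + d').1 = d.1 + d'.1. Proof. by []. Qed.
Lemma sndD (d d' : bideg) : (d + d').2 = d.2 + d'.2. Proof. by []. Qed.
Lemma fstN (d : bideg) : (- d).1 = - d.1. Proof. by []. Qed.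
Lemma sndN (d : bideg) : (- d).2 = - d.2. Proof. by []. Qed.
Lemma fst0 : (0 : bideg).1 = 0. Proof. by []. Qed.
Lemma snd0 : (0 : bideg).2 = 0. Proof. by []. Qed.
Definition bdE := (fstD, sndD, fstN, sndN, fst0, snd0).

Ltac bd_simpl := rewrite ?/step_deg ?/sh ?bdE /=.
Ltac bd_hyps :=
  repeat match goal with
  | s : bool |- _ => destruct s
  | H : _ = _ |- _ => move/bidegE: H; bd_simpl => -[? ?]
  end.
Ltac bd := intros; bd_hyps; try (apply/bidegE; bd_simpl; split); lia.

(* The complex over the two-element field obtained from a complex over [RUV] by
   [U = 1, V = 0] (index [true]) or [U = 0, V = 1] (index [false]). *)
Record gcplx n := GCplx {
  cgr : 'I_n -> bideg;
  cD : bool -> 'M['F_2]_n;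
  cD_deg : forall s i j, cD s i j != 0 ->
    exists k : nat, cgr j = cgr i - (1, 1) + sh s k;
  cD_sq : forall s, cD s *m cD s = 0;
  cD_lead : forall i j, cgr j = cgr i - (1, 1) -> cD true i j = cD false i j }.

Section Side.
Variables (n : nat) (K : gcplx n).
Implicit Types (s : bool) (e : bideg) (x y z : 'rV['F_2]_n) (k m : nat).

Definition restr (P : 'I_n -> Prop) z : 'rV['F_2]_n :=
  \row_j (if `[< P j >] then z 0 j else 0).

(* The elements of bidegree [e], with the variable of side [s] set to 1. *)
Definition fil s e z := forall j, z 0 j != 0 -> exists k : nat, cgr K j = e + sh s k.

Definition conc e z := forall j, z 0 j != 0 -> cgr K j = e.

(** For [z] in [fil s e] this is the reduction modulo the variable of side [s]. *)
Definition lead e z := restr (fun j => cgr K j = e) z.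

(** Bidegrees that differ by a power of a variable merge when it is set to 1; the differential of
    side [s] maps the part on one line to a single line ([line_diff]). *)
Definition line s e j := exists k : int, cgr K j = e + sh s k.

Fact restr_linear P : linear (restr P).
Proof.
move=> a x y; apply/rowP=> j; rewrite !mxE.
by case: asboolP => _ //; rewrite mulr0 addr0.
Qed.

HB.instance Definition _ P := GRing.isLinear.Build _ _ _ _ _ (restr_linear P).

Lemma lead0 e : lead e 0 = 0. Proof. exact: linear0. Qed.
Lemma leadD e x y : lead e (x + y) = lead e x + lead e y. Proof. exact: linearD. Qed.
Lemma leadB e x y : lead e (x - y) = lead e x - lead e y. Proof. exact: linearB. Qed.

Lemma restrE P z j : restr P z 0 j != 0 -> P j.
Proof. by rewrite mxE; case: asboolP => //; rewrite eqxx. Qed.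

Lemma restr_id P z : (forall j, z 0 j != 0 -> P j) -> restr P z = z.
Proof.
move=> Pz; apply/rowP=> j; rewrite mxE; case: asboolP => // nPj.
by apply/esym/eqP; apply/negPn/negP=> /Pz.
Qed.

Lemma restr_eq0 P z j : restr P z = 0 -> P j -> z 0 j = 0.
Proof. by move=> /rowP/(_ j); rewrite !mxE; case: asboolP. Qed.

Lemma rowD_neq0 x y (j : 'I_n) : (x + y) 0 j != 0 -> x 0 j != 0 \/ y 0 j != 0.
Proof.
rewrite mxE; have [->|_] := eqVneq (x 0 j) 0; last by left.
by rewrite add0r; right.
Qed.

Lemma row0_neq0 (j : 'I_n) : (0 : 'rV['F_2]_n) 0 j != 0 -> False.
Proof. by rewrite mxE eqxx. Qed.

Lemma mul_neq0 p q (A : 'M['F_2]_(p, q)) (z : 'rV_p) j :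
  (z *m A) 0 j != 0 -> exists2 i, z 0 i != 0 & A i j != 0.
Proof.
rewrite mxE => zA; have [/existsP[i /andP[zi Ai]]|] :=
  boolP [exists i, (z 0 i != 0) && (A i j != 0)]; first by exists i.
rewrite negb_exists => /forallP nzA; case/eqP: zA; apply: big1 => i _.
by move: (nzA i); rewrite negb_and !negbK => /orP[]/eqP->; rewrite ?mul0r ?mulr0.
Qed.

Lemma fil_additive s e : additive_pred (fil s e).
Proof.
by split=> [j /row0_neq0|x y xe ye j /rowD_neq0[]] //; [apply: xe | apply: ye].
Qed.

Lemma filB s e x y : fil s e x -> fil s e y -> fil s e (x - y).
Proof. by apply: (@additive_predB _ (fil s e)); apply: fil_additive. Qed.

Lemma conc_additive e : additive_pred (conc e).
Proof.
by split=> [j /row0_neq0|x y xe ye j /rowD_neq0[]] //; [apply: xe | apply: ye].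
Qed.

Lemma lead_conc e z : conc e (lead e z).
Proof. by move=> j /restrE. Qed.

Lemma lead_id e z : conc e z -> lead e z = z.
Proof. exact: restr_id. Qed.

Lemma conc_fil s e z : conc e z -> fil s e z.
Proof. by move=> ze j /ze ->; exists 0%N; bd. Qed.

Lemma fil_shift s e e' (k : nat) z : e' = e + sh s k -> fil s e' z -> fil s e z.
Proof. by move=> -> ze j /ze[m gj]; exists (k + m)%N; bd. Qed.

Lemma fil_lead0 s e e' z : e' = e + sh s 1 ->
  fil s e z -> lead e z = 0 -> fil s e' z.
Proof.
move=> e'E ze z0 j zj; have [[|k] gj] := ze j zj; last by exists k; bd.
by case/eqP: zj; apply: restr_eq0 z0 _; bd.
Qed.

Lemma lead_fil0 s e e' k z : e' = e + sh s k.+1 -> fil s e' z -> lead e z = 0.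
Proof.
move=> e'E ze; apply/rowP=> j; rewrite !mxE; case: asboolP => // gj.
by apply/eqP; apply/negPn/negP=> /ze[m gj']; bd.
Qed.

Lemma fil_sub_lead s e e' z : e' = e + sh s 1 -> fil s e z ->
  fil s e' (z - lead e z).
Proof.
move=> e'E ze; apply: fil_lead0 e'E _ _.
  by apply: filB => //; apply: conc_fil; apply: lead_conc.
by rewrite leadB (lead_id (@lead_conc _ _)) subrr.
Qed.

Lemma fil_diff s e e' z : e' = e - (1, 1) -> fil s e z -> fil s e' (z *m cD K s).
Proof.
move=> e'E ze j /mul_neq0[i /ze[k gi] /cD_deg[m gj]].
by exists (k + m)%N; bd.
Qed.

Lemma diffK s z : z *m cD K s *m cD K s = 0.
Proof. by rewrite -mulmxA cD_sq mulmx0. Qed.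

(** Coefficients of the differential between these bidegrees are constants, and [cD_lead] says that
    both sides see the same ones. *)
Lemma lead_diff_conc s s' e e' z : e' = e - (1, 1) -> conc e z ->
  lead e' (z *m cD K s) = lead e' (z *m cD K s').
Proof.
have [-> //|] := eqVneq s s'.
wlog {s s'} -> : s s' / s = true => [wl|].
  case: s s' => [] [] //= _ e'E ze; first exact: wl.
  by apply/esym; apply: wl.
case: s' => // _ e'E ze; apply/rowP=> j; rewrite !mxE; case: asboolP => // gj.
apply: eq_bigr => i _; have [->|/ze gi] := eqVneq (z 0 i) 0; first by rewrite !mul0r.
by congr (_ * _); apply: cD_lead; bd.
Qed.

Lemma line_diff s e e' z : e' = e - (1, 1) ->
  restr (line s e) z *m cD K s = restr (line s e') (z *m cD K s).
Proof.
move=> e'E; apply/rowP=> j; rewrite !mxE; case: asboolP => lj.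
  apply: eq_bigr => i _; rewrite mxE; case: asboolP => // li.
  have [->|/cD_deg[k gj]] := eqVneq (cD K s i j) 0; first by rewrite !mulr0.
  by case: lj => m gj'; case: li; exists (m - k%:Z); bd.
apply: big1 => i _; rewrite mxE; case: asboolP => li; last by rewrite mul0r.
have [->|/cD_deg[k gj]] := eqVneq (cD K s i j) 0; first by rewrite !mulr0.
by case: li => m gi; case: lj; exists (m + k%:Z); bd.
Qed.

End Side.

(** * Arrows *)

Section Relations.
Variables (n : nat) (K : gcplx n).
Implicit Types (s : bool) (e : bideg) (x y z : 'rV['F_2]_n) (k m : nat).

Definition grbound : nat := \sum_j (`|(cgr K j).1| + `|(cgr K j).2|).

Lemma grboundP j : (`|(cgr K j).1| + `|(cgr K j).2| <= grbound)%N.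
Proof. by rewrite /grbound (bigD1 j) //= leq_addr. Qed.

(** Finitely many bidegrees occur, so the filtration vanishes far up and, on each line, is
    everything far down ([fil_small]). *)
Lemma fil_big s e : exists k : nat,
  forall e' z, e' = e + sh s k -> fil K s e' z -> z = 0.
Proof.
exists (grbound + `|e.1| + `|e.2|).+1%N => e' z e'E ze.
apply/rowP=> j; rewrite mxE.
by apply/eqP/negPn/negP=> /ze[m gj]; have := grboundP j; bd.
Qed.

Lemma fil_small s e : exists k : nat,
  forall e' z, e = e' + sh s k -> restr (line K s e) z = z -> fil K s e' z.
Proof.
exists (grbound + `|e.1| + `|e.2|).+1%N => e' z eE <- j /restrE[m gj].
have := grboundP j; exists `|(m + (grbound + `|e.1| + `|e.2|).+1%:Z)%R|%N.
by bd.
Qed.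

(* One arrow of length [k] on side [s], when [e' = e - (1, 1) + sh s k]: then [x] is
   the reduction of a chain whose differential is the [k]-th power of the variable
   times a chain with reduction [y]. *)
Definition arrow s e e' x y := exists z,
  [/\ fil K s e z, fil K s e' (z *m cD K s), lead K e z = x
    & lead K e' (z *m cD K s) = y].

Definition letter s (c : int) e e' x y :=
  if c < 0 then arrow s e e' x y else arrow s e' e y x.

(** Together with [cyc]: boundaries and cycles of the complex reduced modulo both variables. By
    [lead_diff_conc] the side [true] is an arbitrary choice. *)
Definition bdry e x := exists2 w, conc K (e + (1, 1)) w & x = lead K e (w *m cD K true).

Definition cyc e x := conc K e x /\ lead K (e - (1, 1)) (x *m cD K true) = 0.

Lemma arrow_conc s e e' x y : arrow s e e' x y -> conc K e x /\ conc K e' y.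
Proof. by case=> z [_ _ <- <-]; split; apply: lead_conc. Qed.

Lemma letter_conc s c e e' x y : letter s c e e' x y -> conc K e x /\ conc K e' y.
Proof. by rewrite /letter; case: ifP => _ /arrow_conc[]. Qed.

Lemma arrow0 s e e' : arrow s e e' 0 0.
Proof.
exists 0; split; rewrite ?mul0mx ?lead0 //; first exact: (fil_additive K s e).1.
exact: (fil_additive K s e').1.
Qed.

Lemma arrowD s e e' x y x' y' :
  arrow s e e' x y -> arrow s e e' x' y' -> arrow s e e' (x + x') (y + y').
Proof.
move=> [z [ze dz <- <-]] [z' [ze' dz' <- <-]]; exists (z + z').
split; rewrite ?mulmxDl ?leadD //; first exact: (fil_additive K s e).2.
exact: (fil_additive K s e').2.
Qed.

Lemma letter0 s c e e' : letter s c e e' 0 0.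
Proof. by rewrite /letter; case: ifP => _; apply: arrow0. Qed.

Lemma letterD s c e e' x y x' y' :
  letter s c e e' x y -> letter s c e e' x' y' -> letter s c e e' (x + x') (y + y').
Proof. by rewrite /letter; case: ifP => _; apply: arrowD. Qed.

(** The rest [z - lead K e z] is a multiple of the variable, so its differential has no lead at
    [e - (1, 1)]. *)
Lemma lead_cyc s e z : fil K s e z -> lead K (e - (1, 1)) (z *m cD K s) = 0 ->
  cyc e (lead K e z).
Proof.
move=> ze dz; split; first exact: lead_conc.
rewrite (@lead_diff_conc _ K _ s e) //; last exact: lead_conc.
have [e' e'E] : exists e', e' = e + sh s 1 by exists (e + sh s 1).
have z'e := fil_sub_lead e'E ze.
have := fil_diff erefl z'e; rewrite mulmxBl => dz'.
have /(lead_fil0 (e := e - (1, 1)) (k := 0)) := dz'.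
by rewrite leadB dz sub0r => /(_ _)/eqP; rewrite oppr_eq0 => /(_ _)/eqP->//; bd.
Qed.

(** A cycle lifts to itself, and its differential is divisible by the variable because its lead
    vanishes. *)
Lemma cyc_arrow s e e' x : e' = e - (1, 1) + sh s 1 -> cyc e x ->
  exists y, arrow s e e' x y.
Proof.
move=> e'E [xe dx]; exists (lead K e' (x *m cD K s)), x; split=> //.
- exact: conc_fil.
- apply: (fil_lead0 e'E); first exact/(fil_diff erefl)/conc_fil.
  by rewrite -dx; apply: lead_diff_conc xe.
- exact: lead_id.
Qed.

Lemma arrow_cycl s e e' k x y : e' = e - (1, 1) + sh s k.+1 ->
  arrow s e e' x y -> cyc e x.
Proof.
by move=> e'E [z [ze dz <- _]]; apply: lead_cyc ze _; apply: lead_fil0 e'E dz.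
Qed.

Lemma arrow_cycr s e e' x y : arrow s e e' x y -> cyc e' y.
Proof. by move=> [z [_ dz _ <-]]; apply: lead_cyc dz _; rewrite diffK lead0. Qed.

Lemma letter_cyc s c e e' x y : e' = e + step_deg s c -> c != 0 ->
  letter s c e e' x y -> cyc e' y.
Proof.
rewrite /letter; case: ifP => [_ _ _ /arrow_cycr //|/negbT c0 e'E cn0].
by apply: (@arrow_cycl s _ _ `|c|.-1); bd.
Qed.

(* A target is a cycle, hence also the source of arrows of all lengths. *)
Lemma target_source s e e0 e' x y : arrow s e0 e y x -> arrow s e e' x 0.
Proof.
move=> [z [ze dz _ <-]]; exists (z *m cD K s); split; rewrite ?diffK ?lead0 //.
exact: (fil_additive K s e').1.
Qed.

(** Subtracting from the lift the [k.+1]-st power of the variable times [w] cancels the target and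
    keeps the source: the arrow gets longer by one. *)
Lemma arrow_bdryr s e e' e'' k x y : e' = e - (1, 1) + sh s k.+1 -> e'' = e' + sh s 1 ->
  arrow s e e' x y -> bdry e' y -> exists y', arrow s e e'' x y'.
Proof.
move=> e'E e''E [z [ze dz <- <-]] [w we /= zw].
have we' : e' + (1, 1) = e + sh s k.+1 by bd.
have fw : fil K s (e + sh s k.+1) w by rewrite -we'; apply: conc_fil.
exists (lead K e'' ((z - w) *m cD K s)), (z - w); split=> //.
- by apply: filB => //; apply: fil_shift fw.
- have dw : fil K s e' (w *m cD K s) by apply: fil_diff fw; bd.
  apply: fil_lead0 e''E _ _; rewrite mulmxBl.
    exact: filB.
  by rewrite leadB zw (@lead_diff_conc _ K true s _ _ _ _ we) ?subrr //; bd.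
- by rewrite leadB (@lead_fil0 _ K s e (e + sh s k.+1) k w) ?subr0.
Qed.

(** Subtracting the differential of [w] makes the lift divisible by the variable without changing
    its differential; division shortens the arrow by one. *)
Lemma arrow_bdryl s e e' e0 k x y : e = e0 + sh s 1 -> e' = e0 - (1, 1) + sh s k.+2 ->
  arrow s e0 e' x y -> bdry e0 x -> exists x', arrow s e e' x' y.
Proof.
move=> eE e'E [z [ze dz <- <-]] [w we zw].
have dwz : (z - w *m cD K s) *m cD K s = z *m cD K s.
  by rewrite mulmxBl diffK subr0.
exists (lead K e (z - w *m cD K s)), (z - w *m cD K s); split; rewrite ?dwz //.
apply: fil_lead0 eE _ _; last first.
  by rewrite leadB zw (@lead_diff_conc _ K true s _ _ _ _ we) ?subrr //; bd.
apply: filB => //.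
by apply: (@fil_diff _ K s (e0 + (1, 1))); [bd | apply: conc_fil].
Qed.

(** As in [arrow_bdryl], but division now leaves an arrow of length 0, which exhibits [y] as a
    boundary. *)
Lemma arrow_bdry1 s e e' x y : e' = e - (1, 1) + sh s 1 ->
  arrow s e e' x y -> bdry e x -> bdry e' y.
Proof.
move=> e'E [z [ze dz <- <-]] [w we zw].
have dwz : (z - w *m cD K s) *m cD K s = z *m cD K s.
  by rewrite mulmxBl diffK subr0.
have z'e : fil K s (e + sh s 1) (z - w *m cD K s).
  apply: fil_lead0 erefl _ _; last first.
    by rewrite leadB zw (@lead_diff_conc _ K true s _ _ _ _ we) ?subrr //; bd.
  apply: filB => //.
  by apply: (@fil_diff _ K s (e + (1, 1))); [bd | apply: conc_fil].
have e1E : e' + (1, 1) = e + sh s 1 by bd.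
exists (lead K (e' + (1, 1)) (z - w *m cD K s)); first exact: lead_conc.
rewrite -dwz (@lead_diff_conc _ K true s (e' + (1, 1))); last 2 first.
- by bd.
- exact: lead_conc.
apply/eqP; rewrite -subr_eq0 -leadB -mulmxBl; apply/eqP.
apply: (@lead_fil0 _ K s e' (e' + sh s 1) 0) => //.
apply: (@fil_diff _ K s (e + sh s 1 + sh s 1)); first by bd.
by rewrite e1E; apply: fil_sub_lead z'e.
Qed.

(* In the order [1 < 2 < .. < 0 < .. < -2 < -1], the letter [c] is the least one that
   starts at an element of [L]; in the second case this least letter is [0]. *)
Lemma greedy s e (L : 'rV['F_2]_n -> Prop) :
    (exists x, L x) -> (forall x, L x -> cyc e x) ->
    (forall x, L x -> ~ bdry e x) ->
  (exists c, [/\ c != 0, exists x y, L x /\ letter s c e (e + step_deg s c) x y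
    & forall x y, L x -> letter s c e (e + step_deg s c) x y -> ~ bdry (e + step_deg s c) y])
  \/ (exists x z, [/\ L x, fil K s e z, lead K e z = x & z *m cD K s = 0]) /\
     (forall x z, L x -> fil K s e (z *m cD K s) -> lead K e (z *m cD K s) <> x).
Proof.
move=> [x0 Lx0] Lcyc Lbdry.
pose pos k := exists x y, L x /\ arrow s (e + (1, 1) - sh s k.+1) e y x.
pose neg k := exists x y, L x /\ arrow s e (e - (1, 1) + sh s k.+1) x y.
have eP c k : c = k.+1%:Z -> e + step_deg s c = e + (1, 1) - sh s k.+1.
  by move=> ->; bd.
have eN k : e + step_deg s (Negz k) = e - (1, 1) + sh s k.+1 by bd.
have [ex_pos|no_pos] := pselect (exists k, `[< pos k >]).
  left; case: (ex_minnP ex_pos) => k /asboolP[x [y [Lx xy]]] min_k.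
  exists k.+1%:Z; rewrite /letter /= (eP _ k erefl).
  split=> // [|x' y' Lx' xy' y'b]; first by exists x, y.
  (* If the end [y'] were a boundary, the arrow could be shortened, against the choice of [k]; an
     arrow of length 1 would make [x'] a boundary. *)
  case: k {xy eP} min_k xy' y'b => [|k] min_k xy' y'b.
    by apply: Lbdry (Lx') (arrow_bdry1 _ xy' y'b); bd.
  have [y1 xy1] : exists y1, arrow s (e + (1, 1) - sh s k.+1) e y1 x'.
    by apply: (@arrow_bdryl s _ _ _ k) xy' y'b; bd.
  have pk : pos k by exists x', y1.
  by have := min_k k (asboolT pk); rewrite ltnn.
have neg0 : neg 0%N.
  have [y xy] : exists y, arrow s e (e - (1, 1) + sh s 1) x0 y.
    by apply: cyc_arrow => //; apply: Lcyc.
  by exists x0, y.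
(* Without positive letters the least one is the most negative, found just before [neg] first
   fails. *)
have [ex_neg|no_neg] := pselect (exists k, `[< ~ neg k >]).
  left; case: (ex_minnP ex_neg) => -[/asboolP/(_ neg0) //|k] /asboolP nk min_k.
  have [x [y [Lx xy]]] : neg k.
    by apply: contrapT => nk'; have := min_k k (asboolT nk'); rewrite ltnn.
  exists (Negz k); rewrite /letter /= eN.
  split=> // [|x' y' Lx' xy' y'b]; first by exists x, y.
  have [y1 xy1] : exists y1, arrow s e (e - (1, 1) + sh s k.+2) x' y1.
    by apply: (@arrow_bdryr s _ _ _ k) xy' y'b; bd.
  by apply: nk; exists x', y1.
right; split=> [|x z Lx dz zx].
  (* Negative arrows of all lengths exist; one longer than the bound of [fil_big] has a lift with
     zero differential. *)
  have [k k0] := fil_big s (e - (1, 1)).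
  have [x [y [Lx [z [ze dz zx _]]]]] : neg k.
    by apply: contrapT => nk; apply: no_neg; exists k; apply/asboolP.
  exists x, z; split=> //; apply: k0 erefl _.
  by apply: (fil_shift (k := 1) _ dz); bd.
(* A chain with such a differential, cut down to its line, lies in some step of the filtration and
   gives a positive letter after all. *)
have [k kP] := fil_small s (e + (1, 1)).
pose z' := restr (line K s (e + (1, 1))) z.
have dz' : z' *m cD K s = z *m cD K s.
  rewrite (@line_diff _ K s _ e); last by bd.
  by apply: restr_id => j /dz[m gj]; exists m.
have z'e : fil K s (e + (1, 1) - sh s k.+1) z'.
  apply: (fil_shift (k := 1) (e' := e + (1, 1) - sh s k)); first by bd.
  apply: kP; first by bd.
  by apply: restr_id => j /restrE.
apply: no_pos; exists k; apply/asboolP; exists x, (lead K (e + (1, 1) - sh s k.+1) z').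
by split=> //; exists z'; rewrite dz'.
Qed.

End Relations.

(** * Duality *)

Section Dual.
Variables (n : nat) (K : gcplx n).

Fact dual_deg s i j : (cD K s)^T i j != 0 ->
  exists k : nat, - cgr K j = - cgr K i - (1, 1) + sh s k.
Proof. by rewrite mxE => /cD_deg[k gij]; exists k; bd. Qed.

Fact dual_sq s : (cD K s)^T *m (cD K s)^T = 0.
Proof. by rewrite -trmx_mul cD_sq trmx0. Qed.

Fact dual_lead i j : - cgr K j = - cgr K i - (1, 1) ->
  (cD K true)^T i j = (cD K false)^T i j.
Proof. by move=> gij; rewrite !mxE; apply: cD_lead; bd. Qed.

Definition dual : gcplx n := GCplx dual_deg dual_sq dual_lead.

End Dual.

Section Adjoint.
Variables (n : nat) (K : gcplx n).
Implicit Types (s : bool) (e : bideg) (x y z : 'rV['F_2]_n) (k m : nat).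

Lemma mul_row_sum z (c : 'cV['F_2]_n) : z *m c = \sum_j (z 0 j * c j 0)%:M.
Proof.
apply/matrixP=> i j; rewrite !ord1 !mxE summxE.
by apply: eq_bigr => k _; rewrite !mxE eqxx.
Qed.

Lemma delta_mul (c : 'cV['F_2]_n) j : delta_mx (0 : 'I_1) j *m c = (c j 0)%:M.
Proof. by rewrite -rowE; apply/matrixP=> i k; rewrite !ord1 !mxE eqxx. Qed.

Lemma delta_neq0 (i j : 'I_n) : (delta_mx 0 j : 'rV['F_2]_n) 0 i != 0 -> i = j.
Proof. by rewrite mxE; case: (i =P j) => // _; rewrite andbF eqxx. Qed.

Lemma scalar1_inj (a b : 'F_2) : a%:M = b%:M :> 'M_1 -> a = b.
Proof. by move/matrixP/(_ 0 0); rewrite !mxE. Qed.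

(** A generator in both supports has bidegree [e] plus and minus a natural multiple of [sh s 1],
    hence exactly [e]: only leads pair. *)
Lemma lead_pair s e e' z c : e' = - e -> fil K s e z -> fil (dual K) s e' c ->
  lead K e z *m (lead (dual K) e' c)^T = z *m c^T.
Proof.
move=> e'E ze ce; rewrite !mul_row_sum; apply: eq_bigr => j _; rewrite !mxE.
have [z0|/ze[k gj]] := eqVneq (z 0 j) 0; first by rewrite z0 if_same !mul0r.
have [c0|/ce[m gj']] := eqVneq (c 0 j) 0; first by rewrite c0 if_same !mulr0.
have gje : cgr K j = e by move: gj'; rewrite /=; bd.
have gje' : cgr (dual K) j = e' by rewrite /=; bd.
by rewrite !asboolT.
Qed.

(** By [lead_pair] both sides equal the pairing of the differential of one lift with the other
    lift. *)
Lemma arrow_pair s e e' x y f g :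
  arrow K s e e' x y -> arrow (dual K) s (- e') (- e) g f -> x *m f^T = y *m g^T.
Proof.
move=> [z [ze dz <- <-]] [c [ce dc <- <-]].
rewrite (lead_pair erefl ze dc) (lead_pair erefl dz ce).
by rewrite trmx_mul trmxK mulmxA.
Qed.

Lemma letter_pair s c e e' x y f g : c != 0 ->
  letter K s c e e' x y -> letter (dual K) s (- c) (- e) (- e') f g ->
  x *m f^T = y *m g^T.
Proof.
rewrite /letter oppr_lt0; case: ltgtP => // c0 _ Kxy Kfg.
  exact: arrow_pair Kxy Kfg.
exact/esym/(arrow_pair Kxy Kfg).
Qed.

Lemma dual_conc_neq0 e f j : conc (dual K) (- e) f -> f 0 j != 0 -> cgr K j = e.
Proof. by move=> fe /fe /=; bd. Qed.

(** The lift is [c] cut down to the bidegrees that differentials from [fil s e] reach. It lies in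
    [fil s (- e')] since [c] vanishes beyond [e']; on [fil s e] its differential is [f], which lives
    at [- e] only. *)
Lemma coarrow s e e' k (f : 'rV_n) (c : 'cV_n) : e' = e - (1, 1) + sh s k ->
    conc (dual K) (- e) f ->
    (forall z, fil K s e z -> z *m cD K s *m c = z *m f^T) ->
    (forall z, fil K s e' z -> lead K e' z = 0 -> z *m c = 0) ->
  arrow (dual K) s (- e') (- e) (lead (dual K) (- e') c^T) f.
Proof.
move=> e'E fe cf c0.
pose d := restr (fun j => exists m, cgr K j = e - (1, 1) + sh s m) c^T.
have dE j : d 0 j != 0 -> exists m, cgr K j = e' - sh s m /\ d 0 j = c j 0.
  move=> dj; have [m gj] := restrE dj.
  move: dj; rewrite /d !mxE asboolT; last by exists m.
  have [le_mk _|lt_km] := leqP m k; first by exists (k - m)%N; split=> //; bd.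
  suff -> : c j 0 = 0 by rewrite eqxx.
  apply: scalar1_inj; rewrite -delta_mul c0 ?scalemx0 ?raddf0 //.
    by move=> i /delta_neq0->; exists (m - k)%N; bd.
  apply/rowP=> i; rewrite [LHS]mxE [RHS]mxE; case: asboolP => // gi.
  by apply/eqP/negPn/negP => /delta_neq0 ij; subst i; bd.
have de : fil (dual K) s (- e') d.
  by move=> j /dE[m [gj _]]; exists m; rewrite /=; bd.
have ddE i m : cgr K i = e + sh s m -> (d *m (cD K s)^T) 0 i = f 0 i.
  move=> gi; apply: scalar1_inj.
  have <- : delta_mx 0 i *m f^T = (f 0 i)%:M by rewrite delta_mul mxE.
  rewrite -cf => [|j /delta_neq0->]; last by exists m.
  rewrite -mulmxA delta_mul; congr _%:M; rewrite !mxE; apply: eq_bigr => j _.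
  rewrite !mxE mulrC; have [->|/cD_deg[m' gj]] := eqVneq (cD K s i j) 0.
    by rewrite !mul0r.
  by rewrite asboolT //; exists (m + m')%N; bd.
have ddf : fil (dual K) s (- e) (d *m (cD K s)^T).
  move=> i di.
  have [|m /= gi] := @fil_diff _ (dual K) s _ (- e' - (1, 1)) _ erefl de i.
    by [].
  have [le_km|lt_mk] := leqP k m; first by exists (m - k)%N; rewrite /=; bd.
  have gi' : cgr K i = e + sh s (k - m)%N by bd.
  by move: di; rewrite (ddE _ _ gi') => /(dual_conc_neq0 fe) gi''; bd.
exists d; split=> //.
  apply/rowP=> j; rewrite !mxE; case: asboolP => //= gj.
  by rewrite asboolT //; exists k; bd.
apply/rowP=> i; rewrite [LHS]mxE; case: asboolP => /= gi.
  by apply: (ddE i 0%N); bd.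
by apply/esym/eqP/negPn/negP=> /fe.
Qed.

(** [fredholm] for the differential on [fil s e], with [B] the elements of [fil s e'] whose lead is
    in [A], gives a functional; its lead is [g]. *)
Lemma adjoint_source s e e' k (A : 'rV_n -> Prop) f :
    e' = e - (1, 1) + sh s k -> additive_pred A -> conc (dual K) (- e) f ->
    (forall z, fil K s e z -> fil K s e' (z *m cD K s) ->
       A (lead K e' (z *m cD K s)) -> z *m f^T = 0) ->
  exists2 g, arrow (dual K) s (- e') (- e) g f
    & forall y, conc K e' y -> A y -> y *m g^T = 0.
Proof.
move=> e'E [A0 AD] fe f0.
pose B y := fil K s e' y /\ A (lead K e' y).
have addB : additive_pred B.
  have [F0 FD] := fil_additive K s e'.
  split=> [|x y [xe xA] [ye yA]]; first by split; rewrite ?lead0.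
  by split; [apply: FD | rewrite leadD; apply: AD].
have [|c [cB cf]] := fredholm (fil_additive K s e) addB (phi := cD K s) (f := f^T).
  by move=> z ze [dz Az]; apply: f0.
exists (lead (dual K) (- e') c^T).
  apply: coarrow e'E fe _ _ => [z ze|z ze z0]; first by rewrite cf.
  by apply: cB; split; rewrite ?z0.
move=> y ye yA; transitivity (y *m c); last first.
  by apply: cB; split; [apply: conc_fil | rewrite lead_id].
rewrite !mul_row_sum; apply: eq_bigr => j _; rewrite !mxE.
have [->|/ye gj] := eqVneq (y 0 j) 0; first by rewrite !mul0r.
by rewrite asboolT //= gj.
Qed.

(** Now the conditions bear on [z] and on its differential, so [fredholm] is applied to the map from
    [z] to this pair. The first half of the functional is [g]; the second vanishes on [fil s e], so
    subtracting it from [f] keeps the lead. *)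
Lemma adjoint_target s e e' k (A : 'rV_n -> Prop) f :
    e = e' - (1, 1) + sh s k -> additive_pred A -> conc (dual K) (- e) f ->
    (forall z, fil K s e' z -> fil K s e (z *m cD K s) ->
       A (lead K e' z) -> z *m cD K s *m f^T = 0) ->
  exists2 g, arrow (dual K) s (- e) (- e') f g
    & forall y, conc K e' y -> A y -> y *m g^T = 0.
Proof.
move=> eE [A0 AD] fe f0.
pose B (y : 'rV['F_2]_(n + n)) := A (lead K e' (lsubmx y)) /\ fil K s e (rsubmx y).
have addB : additive_pred B.
  have [F0 FD] := fil_additive K s e.
  split=> [|x y [xA xe] [yA ye]]; first by split; rewrite linear0 ?lead0.
  by split; rewrite linearD ?leadD; [apply: AD | apply: FD].
have [|c [cB cf]] := fredholm (fil_additive K s e') addB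
    (phi := row_mx 1%:M (cD K s)) (f := cD K s *m f^T).
  move=> z ze; rewrite mul_mx_row mulmx1 => -[]; rewrite row_mxKl row_mxKr => Az dz.
  by rewrite mulmxA; apply: f0.
have c1 y : A (lead K e' y) -> y *m usubmx c = 0.
  move=> Ay; have <- : row_mx y 0 *m c = y *m usubmx c.
    by rewrite -{1}[c]vsubmxK mul_row_col mul0mx addr0.
  by apply: cB; split; rewrite ?row_mxKl // row_mxKr; case: (fil_additive K s e).
have c2 y : fil K s e y -> y *m dsubmx c = 0.
  move=> ye; have <- : row_mx 0 y *m c = y *m dsubmx c.
    by rewrite -{1}[c]vsubmxK mul_row_col mul0mx add0r.
  by apply: cB; split; rewrite ?row_mxKr // row_mxKl lead0.
have {}cf z : fil K s e' z ->
    z *m cD K s *m (f^T - dsubmx c) = z *m (usubmx c)^T^T.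
  move=> ze; rewrite trmxK mulmxBr -mulmxA cf // mul_mx_row mulmx1.
  by rewrite -{1}[c]vsubmxK mul_row_col addrK.
have g1e : conc (dual K) (- e') (usubmx c)^T.
  move=> j; rewrite mxE => cj; apply: contrapT => /= gj; case/eqP: cj.
  apply: scalar1_inj; rewrite -delta_mul c1 ?raddf0 //.
  suff -> : lead K e' (delta_mx 0 j) = 0 by [].
  apply/rowP=> i; rewrite [LHS]mxE [RHS]mxE; case: asboolP => // gi.
  by apply/eqP/negPn/negP=> /delta_neq0 ij; case: gj; rewrite -ij gi.
exists (usubmx c)^T => [|y ye Ay]; last by rewrite trmxK c1 ?lead_id.
have -> : f = lead (dual K) (- e) (f^T - dsubmx c)^T.
  apply/rowP=> j; rewrite [RHS]mxE; case: asboolP => /= gj.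
    suff d0 : dsubmx c j 0 = 0 by rewrite mxE mxE [(- dsubmx c) j 0]mxE d0 subr0 mxE.
    apply: scalar1_inj; rewrite -delta_mul c2 ?raddf0 //.
    by apply: conc_fil => i /delta_neq0->; bd.
  by apply/eqP/negPn/negP=> /fe.
apply: coarrow eE g1e cf _ => z ze z0; rewrite mulmxBr c2 // subr0.
rewrite mul_row_sum big1 // => j _; rewrite mxE.
have [->|/(dual_conc_neq0 fe) gj] := eqVneq (f 0 j) 0; first by rewrite mulr0 raddf0.
by rewrite (restr_eq0 z0) ?mul0r ?raddf0.
Qed.

(** [fredholm] gives [g] vanishing on [fil s e] with the same values as [f] on all boundaries. So
    [f - g] is a cocycle with lead [f]; its part on the line of [- e] lies in the filtration. *)
Lemma cocycle_lift s e f : conc (dual K) (- e) f ->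
    (forall z, fil K s e (z *m cD K s) -> z *m cD K s *m f^T = 0) ->
  exists c, [/\ fil (dual K) s (- e) c, c *m cD (dual K) s = 0
    & lead (dual K) (- e) c = f].
Proof.
move=> fe f0; have addT : additive_pred (fun _ : 'rV['F_2]_n => True) by [].
have [|g [gB gf]] := fredholm addT (fil_additive K s e) (phi := cD K s)
    (f := cD K s *m f^T).
  by move=> z _ ze; rewrite mulmxA f0.
have g0 j m : cgr K j = e + sh s m -> g j 0 = 0.
  move=> gj; apply: scalar1_inj; rewrite -delta_mul gB ?raddf0 //.
  by move=> i /delta_neq0->; exists m.
exists (restr (line (dual K) s (- e)) (f - g^T)); split.
- move=> j lj; have [k /= gj] := restrE lj; case: k gj => [k|k] gj.
    by exists k.
  have gj' : cgr K j = e + sh s k.+1 by bd.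
  move: lj; rewrite !mxE (g0 _ _ gj') oppr0 addr0.
  by case: asboolP => _; [move=> /(dual_conc_neq0 fe)|]; [bd | rewrite eqxx].
- rewrite (@line_diff _ (dual K) s _ (- e - (1, 1))) //=.
  suff -> : (f - g^T) *m (cD K s)^T = 0 by rewrite linear0.
  apply: trmx_inj; rewrite trmx_mul [(f - _)^T]linearB /= !trmxK trmx0 mulmxBr.
  apply/row_matrixP=> i; rewrite row0 rowE mulmxBr gf // -mulmxA.
  by rewrite subrr.
- apply/rowP=> j; rewrite [LHS]mxE /=.
  case: (pselect (- cgr K j = - e)) => gj; [rewrite asboolT // | rewrite asboolF //].
    have lj : line (dual K) s (- e) j by exists 0; move: gj => /=; bd.
    have gj' : cgr K j = e + sh s 0%N by bd.
    by rewrite mxE asboolT // !mxE (g0 _ _ gj') subr0.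
  by apply/esym/eqP/negPn/negP=> /fe.
Qed.

Lemma cycle_boundary_pair s e z c : fil K s e z -> z *m cD K s = 0 ->
  fil (dual K) s (- e) (c *m cD (dual K) s) ->
  lead K e z *m (lead (dual K) (- e) (c *m cD (dual K) s))^T = 0.
Proof.
move=> ze dz ce; rewrite (lead_pair erefl ze ce) /= trmx_mul trmxK mulmxA dz.
by rewrite mul0mx.
Qed.

Lemma boundary_cocycle_pair s e z c : fil K s e (z *m cD K s) ->
  fil (dual K) s (- e) c -> c *m cD (dual K) s = 0 ->
  lead K e (z *m cD K s) *m (lead (dual K) (- e) c)^T = 0.
Proof.
move=> ze ce dc; rewrite (lead_pair erefl ze ce) -mulmxA.
by rewrite -[cD K s]trmxK -trmx_mul dc trmx0 mulmx0.
Qed.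

End Adjoint.

(** * Walks *)

Section Walks.
Variables (n : nat) (K : gcplx n).
Implicit Types (s : bool) (e : bideg) (x y z : 'rV['F_2]_n) (b : seq int).
Implicit Types E : bool -> bideg -> 'rV['F_2]_n -> Prop.

Fixpoint walk s e b E x : Prop :=
  if b is c :: b' then
    exists2 y, letter K s c e (e + step_deg s c) x y & walk (~~ s) (e + step_deg s c) b' E y
  else E s e x.

Fixpoint dg s e b (i : nat) : bideg :=
  match i, b with
  | i'.+1, c :: b' => dg (~~ s) (e + step_deg s c) b' i'
  | _, _ => e
  end.

Lemma dg0 s e b : dg s e b 0 = e. Proof. by case: b. Qed.

Lemma dgS s e b i : (i < size b)%N ->
  dg s e b i.+1 = dg s e b i + step_deg (s (+) odd i) b`_i.
Proof.
elim: b s e i => [//|c b IH] s e [_|i] /=; first by rewrite dg0 addbF.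
by rewrite ltnS => /IH->; rewrite addNb addbN.
Qed.

Lemma dgN s e b i : dg s (- e) (map -%R b) i = - dg s e b i.
Proof.
elim: b s e i => [|c b IH] s e [|i] //=; rewrite -IH; congr dg.
by bd.
Qed.

Lemma dg_parity s e b i : 0 \notin b -> (i <= size b)%N ->
  exists k : int, (dg s e b i).1 = e.1 + i%:Z + 2 * k.
Proof.
elim: b s e i => [|c b IH] s e [|i] //=; try by exists 0; lia.
rewrite inE negb_or ltnS => /andP[c0 /IH{}IH] /IH{}IH.
have [k ->] := IH (~~ s) (e + step_deg s c).
exists (k + if s then (if 0 < c then - c else - c - 1) else (if 0 < c then 0 else -1)).
by case: s {IH}; rewrite /step_deg /sh !bdE /=; case: ifP; lia.
Qed.

Lemma walk_end s e b E x : walk s e b E x <->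
  exists y, E (s (+) odd (size b)) (dg s e b (size b)) y
    /\ walk s e b (fun _ _ y' => y' = y) x.
Proof.
elim: b s e x => [|c b IH] s e x /=.
  by rewrite addbF; split=> [xE|[y [yE ->]]//]; exists x.
split=> [[x' xx' /IH[y [yE yx']]]|[y [yE [x' xx' yx']]]].
  by exists y; split; [rewrite addbN -addNb | exists x'].
by exists x' => //; apply/IH; exists y; split=> //; rewrite addNb -addbN.
Qed.

Lemma walk_rcons s e b c E x : walk s e (rcons b c) E x <->
  walk s e b (fun s' e' y => exists2 y', letter K s' c e' (e' + step_deg s' c) y y'
    & E (~~ s') (e' + step_deg s' c) y') x.
Proof.
elim: b s e x => [|c' b IH] s e x /=; first by [].
by split=> -[y xy /IH yE]; exists y.
Qed.

Lemma walk_additive s e b E : (forall s e, additive_pred (E s e)) ->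
  additive_pred (walk s e b E).
Proof.
move=> addE; elim: b s e => [|c b IH] s e //=.
have [IH0 IHD] := IH (~~ s) (e + step_deg s c).
split=> [|x y [x' xx' Ex'] [y' yy' Ey']]; first by exists 0; first exact: letter0.
by exists (x' + y'); [apply: letterD | apply: IHD].
Qed.

Lemma walk_cyc s e b x y : 0 \notin b -> cyc K e x ->
  walk s e b (fun _ _ y' => y' = y) x -> cyc K (dg s e b (size b)) y.
Proof.
elim: b s e x => [|c b IH] s e x /=; first by move=> _ xe <-.
rewrite inE negb_or eq_sym => /andP[c0 b0] _ [x' xx' x'y].
by apply: IH x'y => //; apply: letter_cyc xx'.
Qed.

Lemma walk_seq s e b E x : walk s e b E x -> exists X : nat -> 'rV['F_2]_n,
  [/\ X 0%N = x,
    forall i, (i < size b)%N ->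
      letter K (s (+) odd i) b`_i (dg s e b i) (dg s e b i.+1) (X i) (X i.+1)
    & E (s (+) odd (size b)) (dg s e b (size b)) (X (size b))].
Proof.
elim: b s e x => [|c b IH] s e x /=.
  by move=> xE; exists (fun=> x); rewrite addbF.
case=> y xy /IH[X [X0 Xrel XE]].
exists (fun i => if i is i'.+1 then X i' else x); split=> // [[_|i]|] /=.
- by rewrite addbF X0 dg0.
- by rewrite ltnS addbN -addNb => /Xrel.
- by rewrite addbN -addNb.
Qed.

End Walks.

(** * Terminal walks and their dual walks *)

Section Strands.
Variables (n : nat) (K : gcplx n).
Implicit Types (s : bool) (e : bideg) (x y z : 'rV['F_2]_n) (b : seq int).
Implicit Types E : bool -> bideg -> 'rV['F_2]_n -> Prop.

Definition perp E s e (f : 'rV['F_2]_n) :=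
  conc (dual K) e f /\ forall x, conc K (- e) x -> E s (- e) x -> x *m f^T = 0.

(** Induction on the letters: [adjoint_source] or [adjoint_target], by the sign of the first letter,
    moves [f] to a functional that kills all starts of walks with the remaining letters. *)
Lemma walk_perp s e b E f : (forall s e, additive_pred (E s e)) -> 0 \notin b ->
    conc (dual K) (- e) f ->
    (forall x, conc K e x -> walk K s e b E x -> x *m f^T = 0) ->
  walk (dual K) s (- e) (map -%R b) (perp E) f.
Proof.
move=> addE; elim: b s e f => [|c b IH] s e f /=.
  by move=> _ fe fE; split; rewrite // opprK.
rewrite inE negb_or eq_sym => /andP[c0 b0] fe fE.
have eN : - e + step_deg s (- c) = - (e + step_deg s c) by bd.
have addA := walk_additive K (~~ s) (e + step_deg s c) b addE.
rewrite eN /letter oppr_lt0.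
have [c_gt0|c_lt0|/eqP] := ltgtP c 0; last by rewrite (negPf c0).
- have [||g gf gE] := @adjoint_source _ K s e (e + step_deg s c) `|c|%N _ f _ addA fe.
  + by bd.
  + move=> z ze dz zE; rewrite -[f](lead_id fe).
    have <- : lead K e z *m f^T = z *m (lead (dual K) (- e) f)^T.
      rewrite -[in LHS](lead_id fe) (lead_pair erefl ze) //; first by rewrite lead_id.
      exact: conc_fil.
    apply: fE; first exact: lead_conc.
    exists (lead K (e + step_deg s c) (z *m cD K s)) => //.
    by rewrite /letter c_gt0; exists z.
  exists g => //; apply: IH => //; exact: (arrow_conc gf).1.
- have [||g gf gE] := @adjoint_target _ K s e (e + step_deg s c) `|c|%N _ f _ addA fe.
  + by bd.
  + move=> z ze dz zE; rewrite -[f](lead_id fe).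
    have <- : lead K e (z *m cD K s) *m f^T = z *m cD K s *m (lead (dual K) (- e) f)^T.
      rewrite -[in LHS](lead_id fe) (lead_pair erefl dz) //; first by rewrite lead_id.
      exact: conc_fil.
    apply: fE; first exact: lead_conc.
    exists (lead K (e + step_deg s c) z) => //.
    by rewrite /letter ltNge ltW //=; exists z.
  exists g => //; apply: IH => //; exact: (arrow_conc gf).2.
Qed.

(* [below c' c] means that [- c'] precedes [- c] in the order of [greedy]. *)
Definition below (c' c : int) := (c' < 0 < c) || ((c' < 0) == (c < 0)) && (c < c').

(** For equal signs the other end for [c'] lies strictly deeper in the filtration than [e1], so its
    lead there is 0. For opposite signs [y] is a target, and [target_source] applies. *)
Lemma letter_below s c c' e1 e1' e x y : c != 0 -> c' != 0 -> below c' c ->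
  e = e1 + step_deg s c -> e = e1' + step_deg s c' ->
  letter K s c' e1' e x y -> letter K s c e1 e 0 y.
Proof.
rewrite /below /letter => c0 c'0 c'c eE eE'.
have [c'neg|c'pos] := ltP c' 0; have [cneg|cpos] := ltP c 0.
- case=> z [ze dz _ <-]; have [k kE] : exists k : nat, e1' = e1 + sh s k.+1.
    by exists `|c' - c|.-1%N; bd.
  exists z; split=> //; first exact: fil_shift kE ze.
  exact: lead_fil0 kE ze.
- exact: target_source.
- by exfalso; lia.
- case=> z [ze dz <- _]; have [k kE] : exists k : nat, e1' = e1 + sh s k.+1.
    by exists `|c' - c|.-1%N; bd.
  exists z; split=> //; first exact: fil_shift kE dz.
  exact: lead_fil0 kE dz.
Qed.

(** Reductions of torsion cycles: with the variable set to 1, a cycle is torsion when it is the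
    differential of a chain anywhere in the filtration. *)
Definition tors s e x := exists2 w,
  fil K s e (w *m cD K s) & lead K e (w *m cD K s) = x.

Lemma tors_additive s e : additive_pred (tors s e).
Proof.
have [F0 FD] := fil_additive K s e.
split=> [|_ _ [x xe <-] [y ye <-]]; first by exists 0; rewrite mul0mx ?lead0.
by exists (x + y); rewrite mulmxDl ?leadD //; apply: FD.
Qed.

Lemma lead_mul e x f : conc K e x ->
  x *m (lead (dual K) (- e) f)^T = x *m f^T.
Proof.
move=> xe; rewrite !mul_row_sum; apply: eq_bigr => j _; rewrite !mxE.
have [->|/xe gj] := eqVneq (x 0 j) 0; first by rewrite !mul0r.
by rewrite asboolT //= gj.
Qed.

(** A functional that separates [t] from [P] kills [tors], which is the condition of
    [cocycle_lift]. *)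
Lemma cocycle_sep s e (P : 'rV['F_2]_n -> Prop) t : additive_pred P ->
    (forall x, tors s e x -> P x) -> conc K e t -> ~ P t ->
  exists c, [/\ fil (dual K) s (- e) c, c *m cD (dual K) s = 0,
    forall x, conc K e x -> P x -> x *m (lead (dual K) (- e) c)^T = 0
    & t *m (lead (dual K) (- e) c)^T = 1%:M].
Proof.
move=> addP torsP te nPt; have [f [fP ft]] := additive_pred_sep addP nPt.
have fe := @lead_conc _ (dual K) (- e) f.
have [|c [ce dc cf]] := @cocycle_lift _ K s e _ fe.
  move=> z ze; rewrite -[RHS](fP (lead K e (z *m cD K s))); last first.
    by apply: torsP; exists z.
  have := lead_pair erefl ze (conc_fil s fe); rewrite (lead_id fe) => <-.
  by rewrite lead_mul //; apply: lead_conc.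
by exists c; rewrite cf lead_mul //; split=> // x xe Px; rewrite lead_mul // fP.
Qed.

Variable e0 : bideg.

(** Reductions of nontorsion cycles on the side of [V]; in the application [e0] is a bidegree given
    by [tower_max]. *)
Definition tower x := exists z,
  [/\ fil K false e0 z, z *m cD K false = 0, ~ (exists w, z = w *m cD K false)
    & lead K e0 z = x].

Hypothesis tower_ex : exists x, tower x.
Hypothesis tower_not_tors : forall x, tower x -> ~ tors false e0 x.
Hypothesis tower_diff : forall x y, tower x -> tower y -> tors false e0 (x - y).
Hypothesis nontorsion_deg : forall e z, fil K false e z -> z *m cD K false = 0 ->
  ~ (exists w, z = w *m cD K false) -> e.1 = 0.

Lemma tower_sub_tors x t : tower x -> tors false e0 t -> tower (x - t).
Proof.
move=> [z [ze dz zB <-]] [w we <-]; exists (z - w *m cD K false); split.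
- exact: filB.
- by rewrite mulmxBl dz diffK subr0.
- by case=> v /eqP; rewrite subr_eq -mulmxDl => /eqP zE; apply: zB; exists (v + w).
- by rewrite leadB.
Qed.

Lemma tower_conc x : tower x -> conc K e0 x.
Proof. by case=> z [_ _ _ <-]; apply: lead_conc. Qed.

Lemma tower_cyc x : tower x -> cyc K e0 x.
Proof.
by case=> z [ze dz _ <-]; apply: lead_cyc ze _; rewrite dz lead0.
Qed.

(** No tower element is a start of a walk plus torsion, since removing torsion stays in the tower.
    The cocycle that separates one of them from these sums is 1 on all of them, as they differ by
    torsion. *)
Lemma dual_start b E : (forall s e, additive_pred (E s e)) -> 0 \notin b ->
    (forall x, tower x -> ~ walk K true e0 b E x) ->
  exists c, [/\ fil (dual K) false (- e0) c, c *m cD (dual K) false = 0,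
    walk (dual K) true (- e0) (map -%R b) (perp E) (lead (dual K) (- e0) c)
    & forall x, tower x -> x *m (lead (dual K) (- e0) c)^T = 1%:M].
Proof.
move=> addE b0 towerE; have [x0 x0T] := tower_ex.
have [A0 AD] := walk_additive K true e0 b addE.
have [T0 TD] := tors_additive false e0.
pose P x := exists a t, [/\ walk K true e0 b E a, tors false e0 t & x = a + t].
have addP : additive_pred P.
  split=> [|_ _ [a [t [aA tT ->]]] [a' [t' [aA' tT' ->]]]].
    by exists 0, 0; rewrite addr0.
  by exists (a + a'), (t + t'); split; [apply: AD | apply: TD | rewrite addrACA].
have torsP x : tors false e0 x -> P x by move=> xT; exists 0, x; rewrite add0r.
have [|c [ce dc cP cx0]] := cocycle_sep addP torsP (tower_conc x0T).
  case=> a [t [aA tT x0E]]; apply: (towerE a) => //.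
  by have := tower_sub_tors x0T tT; rewrite x0E addrK.
exists c; split=> // [|x xT].
  apply: walk_perp => // [|x xe xA]; first exact: lead_conc.
  by apply: cP => //; exists x, 0; rewrite addr0.
have xe := tower_conc xT; have x0e := tower_conc x0T.
have := cP _ (additive_predB (conc_additive K e0) xe x0e) (torsP _ (tower_diff xT x0T)).
by rewrite mulmxBl cx0 => /eqP; rewrite subr_eq0 => /eqP.
Qed.

Definition good b := [/\ 0 \notin b,
  exists2 x, tower x & walk K true e0 b (fun _ _ _ => True) x
  & forall x, tower x -> ~ walk K true e0 b (fun _ => bdry K) x].

(** The situation in which [greedy] chooses 0: some end lifts to a cycle, and no end is torsion, as
    [dual_start] requires. *)
Definition terminal b := [/\ 0 \notin b,
  exists2 x, tower x & walk K true e0 b (fun s e y => exists z,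
    [/\ fil K s e z, z *m cD K s = 0 & lead K e z = y]) x
  & forall x, tower x -> ~ walk K true e0 b tors x].

Lemma good_nil : good [::].
Proof.
split=> // [|x xT /= [w we xE]].
  by have [x xT] := tower_ex; exists x.
apply: (tower_not_tors xT); exists w; last first.
  by rewrite xE (@lead_diff_conc _ K true false _ _ _ _ we) //; bd.
by apply: (@fil_diff _ K false (e0 + (1, 1))); [bd | apply: conc_fil].
Qed.

Lemma good_step b : good b -> (exists c, good (rcons b c)) \/ terminal b.
Proof.
move=> [b0 [x0 x0T /walk_end[y0 [_ x0y0]]] xB].
pose L y := exists2 x, tower x & walk K true e0 b (fun _ _ y' => y' = y) x.
have [||||] := @greedy _ K (true (+) odd (size b)) (dg true e0 b (size b)) L.
- by exists y0, x0.
- by move=> y [x /tower_cyc xc xy]; apply: walk_cyc xy.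
- move=> y [x xT xy] yB; apply: (xB x xT); apply/walk_end.
  by exists y.
- case=> c [c0 [y [y' [[x xT xy] yy']]] yB]; left; exists c; split.
  + by rewrite mem_rcons inE negb_or eq_sym c0.
  + by exists x => //; apply/walk_rcons/walk_end; exists y; split=> //; exists y'.
  + move=> x1 x1T /walk_rcons/walk_end[y1 [[y2 y12 y2B] x1y1]].
    by apply: yB y12 y2B; exists x1.
- case=> [[y [z [[x xT xy] ze zy dz]]] noB]; right; split=> // [|x1 x1T].
    by exists x => //; apply/walk_end; exists y; split=> //; exists z.
  move=> /walk_end[y1 [[w we wy1] x1y1]]; apply: noB we wy1.
  by exists x1.
Qed.

(* Equal vectors at two positions of a walk would force, going left from both, equal
   letters all the way to the start of the walk, and there a contradiction. *)
Lemma no_collision b (X F : nat -> 'rV['F_2]_n) z c d :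
    0 \notin b ->
    (forall i, (i < size b)%N -> letter K (true (+) odd i) b`_i
      (dg true e0 b i) (dg true e0 b i.+1) (X i) (X i.+1)) ->
    (forall i, (i < size b)%N -> letter (dual K) (true (+) odd i) (- b`_i)
      (- dg true e0 b i) (- dg true e0 b i.+1) (F i) (F i.+1)) ->
    fil K false e0 z -> z *m cD K false = 0 -> lead K e0 z = X 0%N ->
    fil (dual K) false (- e0) c -> c *m cD (dual K) false = 0 ->
    lead (dual K) (- e0) c = F 0%N ->
    (0 < d)%N -> ~~ odd d ->
  forall i, (i + d <= size b)%N -> dg true e0 b i = dg true e0 b (i + d) ->
    X (i + d)%N *m (F i)^T != 0 -> X i *m (F (i + d)%N)^T != 0 -> False.
Proof.
move=> b0 Xrel Frel ze dz zX ce dc cF d_gt0 d_even.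
have bn0 i : (i < size b)%N -> b`_i != 0.
  by move=> lt_ib; apply: contraNneq b0 => <-; apply: mem_nth.
elim=> [|i IH].
  (* The letter before the even position acts on the side of [V]. By its sign it makes the later [X]
     a boundary, which pairs to 0 with the cocycle at [F 0], or the later [F] a coboundary, which
     pairs to 0 with the cycle at [X 0]. *)
  rewrite add0n dg0 => le_db dgE; case: d d_gt0 d_even le_db dgE => // d _ /=.
  rewrite negbK => d_odd lt_db dgE.
  move/Xrel: (lt_db); move/Frel: (lt_db); rewrite d_odd /letter oppr_lt0 -dgE -zX -cF.
  have := bn0 _ lt_db; have [c_gt0|c_lt0|//] := ltgtP b`_d 0.
    move=> _ _ [w [_ we _ <-]]; rewrite (boundary_cocycle_pair we ce dc).
    by rewrite eqxx.
  by move=> _ [w [_ we _ <-]] _ _; rewrite (cycle_boundary_pair ze dz we) eqxx.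
rewrite addSn => lt_b dgE XF FX.
have lt_i : (i < size b)%N by lia.
have bi := bn0 _ lt_i; have bid := bn0 _ lt_b.
have sE : odd (i + d) = odd i by rewrite oddD (negPf d_even) addbF.
have Xi := Xrel _ lt_i; have Fi := Frel _ lt_i.
have Xid := Xrel _ lt_b; have Fid := Frel _ lt_b; rewrite sE in Xid Fid.
have dgi := dgS true e0 lt_i; have dgid := dgS true e0 lt_b; rewrite sE in dgid.
(* Equal letters carry both pairings one position to the left; for different ones [letter_below]
   replaces a start by 0 and kills a pairing. *)
have [bE|/orP[]] : b`_i = b`_(i + d) \/ below b`_(i + d) b`_i || below b`_i b`_(i + d).
- by rewrite /below; lia.
- have dgE' : dg true e0 b i = dg true e0 b (i + d).
    by apply: (addIr (step_deg (true (+) odd i) b`_i)); rewrite -dgi bE -dgid.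
  have Fi' := Fi; rewrite bE dgE' dgE in Fi'.
  have Xi' := Xi; rewrite bE dgE' dgE in Xi'.
  apply: IH => //; first lia.
    by rewrite (letter_pair bid Xid Fi').
  by rewrite (letter_pair bid Xi' Fid).
- move=> lt_bb; have Fi' := Fi; rewrite dgE in Fi'.
  have X0 := letter_below bi bid lt_bb (etrans (esym dgE) dgi) dgid Xid.
  by have := letter_pair bi X0 Fi'; rewrite mul0mx => /esym/eqP; rewrite (negPf XF).
- move=> lt_bb; have Xi' := Xi; rewrite dgE in Xi'.
  have X0 := letter_below bid bi lt_bb dgid (etrans (esym dgE) dgi) Xi'.
  by have := letter_pair bid X0 Fid; rewrite mul0mx => /esym/eqP; rewrite (negPf FX).
Qed.

Lemma dual_walk_seq b E f : walk (dual K) true (- e0) (map -%R b) E f ->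
  exists F : nat -> 'rV['F_2]_n, [/\ F 0%N = f,
    forall i, (i < size b)%N -> letter (dual K) (true (+) odd i) (- b`_i)
      (- dg true e0 b i) (- dg true e0 b i.+1) (F i) (F i.+1)
    & E (true (+) odd (size b)) (- dg true e0 b (size b)) (F (size b))].
Proof.
case/walk_seq=> F; rewrite size_map dgN => -[F0 Frel FE]; exists F; split=> // i lt_ib.
by have := Frel i lt_ib; rewrite (nth_map 0) // !dgN.
Qed.

Lemma good_size b : good b -> (size b < #|{: 'rV['F_2]_n}|)%N.
Proof.
case=> b0 [x xT /walk_seq[X [X0 Xrel _]]] bB.
(* 0 is a boundary, so no walk of a good sequence from the tower ends there, and [dual_start] yields
   the functionals. *)
pose E0 (_ : bool) (_ : bideg) (y : 'rV['F_2]_n) := y = 0.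
have addE0 s e : additive_pred (E0 s e) by split=> // _ _ -> ->; rewrite /E0 addr0.
have [|c [ce dc /dual_walk_seq[F [F0 Frel _]] cT]] := dual_start addE0 b0.
  move=> y yT /walk_end[_ [-> y0]]; apply: (bB y yT); apply/walk_end.
  exists 0; split=> //; exists 0; last by rewrite mul0mx lead0.
  exact: (conc_additive K _).1.
have XF i : (i <= size b)%N -> X i *m (F i)^T = 1%:M.
  elim: i => [_|i IH lt_ib]; first by rewrite X0 F0 cT.
  rewrite -IH ?(ltnW lt_ib) //.
  have bi : b`_i != 0 by apply: contraNneq b0 => <-; apply: mem_nth.
  exact/esym/(letter_pair bi (Xrel _ lt_ib) (Frel _ lt_ib)).
have Xconc i : (i <= size b)%N -> conc K (dg true e0 b i) (X i).
  case: i => [|i] lt_ib; first by rewrite X0 dg0; apply: tower_conc.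
  exact: (letter_conc (Xrel _ lt_ib)).2.
rewrite ltnNge; apply/negP=> le_cb.
have /injectivePn[i [j ij Xij]] : ~~ injectiveb (fun i : 'I_(size b).+1 => X i).
  apply/negP=> /injectiveP/leq_card; rewrite card_ord => /leq_trans/(_ le_cb).
  by rewrite ltnn.
wlog lt_ij : i j ij Xij / (i < j)%N => [wl|].
  have := ij; rewrite -val_eqE neq_ltn => /orP[]; first exact: wl.
  by apply: wl; rewrite // eq_sym.
have le_ib : (i <= size b)%N by rewrite -ltnS.
have le_jb : (j <= size b)%N by rewrite -ltnS.
have nz1 : (1%:M : 'M['F_2]_1) != 0 by apply/eqP => /matrixP/(_ 0 0); rewrite !mxE.
have dgE : dg true e0 b i = dg true e0 b j.
  have /rV0Pn[l Xl] : X i != 0.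
    by apply: contraNneq nz1 => Xi0; rewrite -(XF _ le_ib) Xi0 mul0mx.
  by rewrite -(Xconc _ le_ib _ Xl); apply: (Xconc _ le_jb); rewrite -Xij.
have d_even : ~~ odd (j - i).
  have [k ik] := dg_parity true e0 b0 le_ib.
  have [k' jk'] := dg_parity true e0 b0 le_jb.
  by rewrite dgE in ik; lia.
have jE : (i + (j - i) = j)%N by lia.
have [z [ze dz _ zX]] := xT; rewrite -X0 in zX.
apply: (no_collision b0 Xrel Frel ze dz zX ce dc (esym F0) _ d_even (i := i)).
- by rewrite subn_gt0.
- by rewrite jE.
- by rewrite jE.
- by rewrite jE -Xij XF.
- by rewrite jE Xij XF.
Qed.

Lemma terminal_ex : exists b, terminal b.
Proof.
apply: contrapT => no_term.
have : forall m, exists2 b, good b & size b = m.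
  elim=> [|m [b bG bm]]; first by exists [::] => //; apply: good_nil.
  case: (good_step bG) => [[c cG]|bT]; last by case: no_term; exists b.
  by exists (rcons b c) => //; rewrite size_rcons bm.
case/(_ #|{: 'rV['F_2]_n}|) => b /good_size lt_b bE.
by rewrite bE ltnn in lt_b.
Qed.

Lemma terminal_even b : terminal b -> ~~ odd (size b).
Proof.
case=> b0 [x xT /walk_end[y [[z [ze dz zy]] xy]]] bT; apply/negP=> b_odd.
rewrite b_odd /= in ze dz.
have [t tT] := tower_ex; have [z0 [z0e dz0 z0B _]] := tT.
have e00 := nontorsion_deg z0e dz0 z0B.
have [[w zw]|zB] := pselect (exists w, z = w *m cD K false).
  apply: (bT x xT); apply/walk_end; exists y; split=> //.
  by exists w; rewrite b_odd /= -zw.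
have := nontorsion_deg ze dz zB.
by have [k ->] := dg_parity true e0 b0 (leqnn (size b)); lia.
Qed.

End Strands.

(* A chain map from the standard complex of [b], in terms of the images of its
   generators: [z] is the image of the first one, and [X k] is the reduction of the
   image of the [k]-th one. *)
Definition strand n (K : gcplx n) e0 b (z : 'rV['F_2]_n) := exists X : nat -> 'rV['F_2]_n,
  [/\ fil K false e0 z, z *m cD K false = 0, lead K e0 z = X 0%N,
    forall i, (i < size b)%N ->
      letter K (~~ odd i) b`_i (dg true e0 b i) (dg true e0 b i.+1) (X i) (X i.+1)
    & exists z', [/\ fil K true (dg true e0 b (size b)) z', z' *m cD K true = 0
      & lead K (dg true e0 b (size b)) z' = X (size b)]].

(** The functional at the end of the dual walk kills torsion, so [cocycle_lift] turns it into the
    final cocycle that a strand needs. *)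
Theorem dual_strands n (K : gcplx n) (e0 : bideg) :
    (exists x, tower K e0 x) ->
    (forall x, tower K e0 x -> ~ tors K false e0 x) ->
    (forall x y, tower K e0 x -> tower K e0 y -> tors K false e0 (x - y)) ->
    (forall e z, fil K false e z -> z *m cD K false = 0 ->
      ~ (exists w, z = w *m cD K false) -> e.1 = 0) ->
  exists b z c, [/\ ~~ odd (size b), 0 \notin b,
    strand K e0 b z /\ ~ (exists w, z = w *m cD K false),
    strand (dual K) (- e0) (map -%R b) c
    & forall z', fil K false e0 z' -> z' *m cD K false = 0 ->
      ~ (exists w, z' = w *m cD K false) -> z' *m c^T = 1%:M].
Proof.
move=> tower_ex tower_tors tower_diff deg0.
have [b bT] := terminal_ex tower_ex tower_tors tower_diff.
have b_even := terminal_even tower_ex deg0 bT.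
have [b0 [x xT /walk_seq[X [X0 Xrel Xend]]] bX] := bT.
have [c [ce dc /dual_walk_seq[F [F0 Frel [Fe Fend]]] cT]] :=
  dual_start tower_ex tower_diff (tors_additive K) b0 bX.
have [z [ze dz zB zx]] := xT.
rewrite (negPf b_even) addbF in Xend Fend.
exists b, z, c; split=> //.
- by split=> //; exists X; split=> //; rewrite X0.
- exists F; rewrite size_map dgN; split=> //.
    by move=> i lt_ib; rewrite (nth_map 0) // !dgN; apply: Frel.
  have [|c' [ce' dc' cF]] := cocycle_lift (s := true) Fe.
    move=> w we; rewrite opprK in Fend.
    have := lead_pair erefl we (conc_fil true Fe); rewrite (lead_id Fe) => <-.
    by apply: Fend; [apply: lead_conc | exists w].
  by exists c'.
- move=> z' ze' dz' zB'; rewrite -(lead_pair erefl ze' ce) cT //.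
  by exists z'.
Qed.

(** * Specializations of the ground ring *)

Section Specialization.
Variable s : bool.

Definition spec_var (i : 'I_2) : {poly 'F_2} := if (i == 0) == s then 'X else 0.

Definition spec0 (p : FUV) : {poly 'F_2} := mmap polyC spec_var p.

HB.instance Definition _ := GRing.RMorphism.copy spec0 (mmap polyC spec_var).

(* [spec true] is the reduction [V = 0] and [spec false] the reduction [U = 0]. *)
Definition spec (r : RUV) : {poly 'F_2} := spec0 (repr r).

Lemma spec_pi (p : FUV) : spec (\pi_{ideal_quot UVideal} p) = spec0 p.
Proof.
apply/eqP; rewrite -subr_eq0 -rmorphB /=; apply/eqP.
have : repr (\pi_{ideal_quot UVideal} p) - p \in UVideal.
  by rewrite Quotient.idealrBE reprK.
case/asboolP=> q ->; rewrite !rmorphM /= /spec0 !mmapX !mmap1U /spec_var.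
by case: s; rewrite /= ?mul0r ?mulr0.
Qed.

Lemma pi_surj (r : RUV) : exists p : FUV, r = \pi_{ideal_quot UVideal} p.
Proof. by exists (repr r); rewrite reprK. Qed.

Fact spec_zmod_morphism : zmod_morphism spec.
Proof.
move=> r r'; have [[p ->] [p' ->]] := (pi_surj r, pi_surj r').
by rewrite -rmorphB !spec_pi rmorphB.
Qed.

Fact spec_monoid_morphism : monoid_morphism spec.
Proof.
split=> [|r r']; first by rewrite -(rmorph1 (\pi_{ideal_quot UVideal})) spec_pi rmorph1.
have [[p ->] [p' ->]] := (pi_surj r, pi_surj r').
by rewrite -rmorphM !spec_pi rmorphM.
Qed.

HB.instance Definition _ :=
  GRing.isZmodMorphism.Build RUV {poly 'F_2} spec spec_zmod_morphism.
HB.instance Definition _ :=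
  GRing.isMonoidMorphism.Build RUV {poly 'F_2} spec spec_monoid_morphism.

Definition ev (r : RUV) : 'F_2 := (spec r).[1].

Fact ev_zmod_morphism : zmod_morphism ev.
Proof. by move=> r r'; rewrite /ev rmorphB hornerD hornerN. Qed.

Fact ev_monoid_morphism : monoid_morphism ev.
Proof.
by split=> [|r r']; rewrite /ev ?rmorph1 ?hornerC // rmorphM hornerM.
Qed.

HB.instance Definition _ :=
  GRing.isZmodMorphism.Build RUV 'F_2 ev ev_zmod_morphism.
HB.instance Definition _ :=
  GRing.isMonoidMorphism.Build RUV 'F_2 ev ev_monoid_morphism.

Lemma spec_U : spec U = if s then 'X else 0.
Proof. by rewrite /U spec_pi /spec0 mmapX mmap1U /spec_var /=; case: s. Qed.

Lemma spec_V : spec V = if s then 0 else 'X.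
Proof. by rewrite /V spec_pi /spec0 mmapX mmap1U /spec_var /=; case: s. Qed.

End Specialization.

Definition uvar (s : bool) : RUV := if s then U else V.

Lemma spec_uvar s s' : spec s (uvar s') = if s == s' then 'X else 0.
Proof. by case: s'; rewrite /uvar ?spec_U ?spec_V; case: s. Qed.

Lemma ev_uvar s s' : ev s (uvar s') = (s == s')%:R.
Proof. by rewrite /ev spec_uvar; case: eqP; rewrite ?hornerX ?horner0. Qed.

Definition cst (a : 'F_2) : RUV := \pi_{ideal_quot UVideal} (a%:MP : FUV).

HB.instance Definition _ := GRing.RMorphism.copy cst
  (\pi_{ideal_quot UVideal} \o @mpolyC 2 'F_2).

Lemma spec_cst s a : spec s (cst a) = a%:P.
Proof. by rewrite /cst spec_pi /spec0 mmapC. Qed.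

Definition poly_var s (p : {poly 'F_2}) : RUV := (map_poly cst p).[uvar s].

Fact poly_var_zmod_morphism s : zmod_morphism (poly_var s).
Proof. by move=> p q; rewrite /poly_var rmorphB hornerD hornerN. Qed.

HB.instance Definition _ s :=
  GRing.isZmodMorphism.Build {poly 'F_2} RUV (poly_var s) (poly_var_zmod_morphism s).

Lemma poly_var_MXaddC s p c : poly_var s (p * 'X + c%:P) = poly_var s p * uvar s + cst c.
Proof.
by rewrite /poly_var rmorphD rmorphM /= map_polyX map_polyC hornerMXaddC.
Qed.

Lemma spec_poly_var s p : spec s (poly_var s p) = p.
Proof.
elim/poly_ind: p => [|p c IH]; first by rewrite !raddf0.
by rewrite poly_var_MXaddC rmorphD rmorphM /= IH spec_uvar eqxx spec_cst.
Qed.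

(** Sorting monomials by divisibility by [U] writes [r] as a polynomial in [V] plus a multiple of
    [U]; [spec false] returns the polynomial. *)
Lemma spec_ker r : spec false r = 0 -> exists t, r = U * t.
Proof.
suff [p [t ->]] : exists p t, r = poly_var false p + U * t.
  rewrite rmorphD rmorphM /= spec_poly_var (spec_uvar _ true) mul0r addr0 => ->.
  by exists t; rewrite raddf0 add0r.
have [q ->] := pi_surj r.
rewrite [q]mpolyE rmorph_sum; elim/big_ind: _ => [|_ _ [p [t ->]] [p' [t' ->]]|m _].
- by exists 0, 0; rewrite raddf0 mulr0 addr0.
- by exists (p + p'), (t + t'); rewrite raddfD mulrDr addrACA.
rewrite mpolyXE_id !big_ord_recl big_ord0 mulr1 -mul_mpolyC !rmorphM !rmorphXn /=.
rewrite -/U -[\pi_(_) 'X_(lift _ _)]/V -/(cst _).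
case: (m ord0) => [|k].
  exists ((q@_m)%:P * 'X^(m (lift ord0 ord0))), 0; rewrite mulr0 addr0 expr0 mul1r.
  by rewrite /poly_var rmorphM rmorphXn /= map_polyC map_polyX !hornerE.
by exists 0, (cst q@_m * U ^+ k * V ^+ m (lift ord0 ord0)); rewrite raddf0 exprS; ring.
Qed.

(** * Chain maps from strands *)

Lemma ev_uvar_exp s s' k : ev s (uvar s' ^+ k) = ((s == s') || (k == 0%N))%:R.
Proof.
rewrite rmorphXn /= ev_uvar; case: eqP => _ /=; first by rewrite expr1n.
by case: k => [|k]; rewrite ?expr0 ?exprS ?mul0r.
Qed.

Lemma homogR_monomial d r : homogR d r ->
  r = 0 \/ exists s (k : nat), d = - sh s k /\ r = uvar s ^+ k.
Proof.
case=> [|[i [j [-> ->]]]]; first by left.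
case: i => [|i]; first by right; exists false, j; rewrite mul1r; split=> //; bd.
case: j => [|j]; first by right; exists true, i.+1; rewrite mulr1; split=> //; bd.
by left; rewrite exprSr exprS -mulrA (mulrA U) UV0 mul0r mulr0.
Qed.

Lemma homogR_uvar s (k : nat) : homogR (- sh s k) (uvar s ^+ k).
Proof.
right; case: s; [exists k, 0%N | exists 0%N, k]; rewrite ?mulr1 ?mul1r.
all: by split=> //; bd.
Qed.

Lemma homogR_sum I (r : seq I) (P : pred I) (F : I -> RUV) d :
  (forall i, P i -> homogR d (F i)) -> homogR d (\sum_(i <- r | P i) F i).
Proof.
move=> homF; elim/big_ind: _ => [|x y|i Pi]; first by left.
  exact: homogRD.
exact: homF.
Qed.

(** A homogeneous element is 0 or a power of one variable, so setting the variable to 1 loses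
    nothing. *)
Lemma homogR_spec0 d s r : homogR d r -> ev s r = 0 -> spec s r = 0.
Proof.
case/homogR_monomial=> [->|[s' [k [_ ->]]]]; first by rewrite !raddf0.
rewrite ev_uvar_exp rmorphXn /= spec_uvar; case: eqP => //= _.
by case: k => //= k _; rewrite exprS mul0r.
Qed.

Lemma homogRB d r r' : homogR d r -> homogR d r' -> homogR d (r - r').
Proof.
have -> : r - r' = r + r' by apply/eqP; rewrite subr_eq -addrA RUV_pchar2 addr0.
exact: homogRD.
Qed.

Lemma homogR_eq0 d r : homogR d r -> (forall s, ev s r = 0) -> r = 0.
Proof.
case/homogR_monomial=> [//|[s [k [_ ->]]]] /(_ s).
by rewrite ev_uvar_exp eqxx => /eqP; rewrite oner_eq0.
Qed.

Lemma homogR_eq d r r' : homogR d r -> homogR d r' ->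
  (forall s, ev s r = ev s r') -> r = r'.
Proof.
move=> rd r'd rr'; apply/eqP; rewrite -subr_eq0; apply/eqP.
apply: (homogR_eq0 (homogRB rd r'd)) => s; by rewrite rmorphB /= rr' subrr.
Qed.

Lemma homogR_spec_eq d s r r' : homogR d r -> homogR d r' -> ev s r = ev s r' ->
  spec s r = spec s r'.
Proof.
move=> rd r'd rr'; apply/eqP; rewrite -subr_eq0 -rmorphB /=; apply/eqP.
by apply: (homogR_spec0 (homogRB rd r'd)); rewrite rmorphB /= rr' subrr.
Qed.

Lemma homogR0_eq1 s r : homogR 0 r -> ev s r = 1 -> r = 1.
Proof.
case/homogR_monomial=> [->|[s' [k [k0 ->]]]].
  by rewrite raddf0 => /esym/eqP; rewrite oner_eq0.
by have -> : k = 0%N by bd.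
Qed.

(** Under the conditions of [hliftP], the homogeneous element of bidegree [d] with prescribed values
    on the two sides; the exponent is read off from [d]. *)
Definition hlift (d : bideg) (a b : 'F_2) : RUV :=
  if a != 0 then U ^+ `|d.1|./2 else if b != 0 then V ^+ `|d.2|./2 else 0.

Lemma hliftP d (f : bool -> 'F_2) :
    (forall s, f s != 0 -> exists k : nat, d = - sh s k) -> (d = 0 -> f true = f false) ->
  homogR d (hlift d (f true) (f false)) /\
  forall s, ev s (hlift d (f true) (f false)) = f s.
Proof.
move=> fd d0; rewrite /hlift.
have [fT|fT] := eqVneq (f true) 0; last first.
  have [k dE] := fd _ fT.
  have -> : `|d.1|./2 = k by bd.
  split=> [|[]]; first by rewrite dE; apply: (homogR_uvar true).
    by rewrite (ev_uvar_exp _ true) eqxx (F2_neq0 fT).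
  rewrite (ev_uvar_exp _ true) /=; case: eqP => [k0|k_neq0].
    by rewrite -d0 ?(F2_neq0 fT) // dE k0; bd.
  apply/esym/eqP/negPn/negP => /fd[m dE']; case: k_neq0; bd.
have [fF|fF] := eqVneq (f false) 0; last first.
  have [k dE] := fd _ fF.
  have -> : `|d.2|./2 = k by bd.
  split=> [|[]]; first by rewrite dE; apply: (homogR_uvar false).
    rewrite (ev_uvar_exp _ false) /= fT; case: eqP => // k0.
    by case/eqP: fF; rewrite -d0 // dE k0; bd.
  by rewrite (ev_uvar_exp _ false) eqxx (F2_neq0 fF).
split=> [|[]]; rewrite ?raddf0 //; by left.
Qed.

Section Matrices.
Variables (n : nat) (A : 'M[RUV]_n) (K : gcplx n).
Hypothesis Ahom : forall i j, homogR (cgr K i - (1, 1) - cgr K j) (A i j).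
Hypothesis AD : forall s, map_mx (ev s) A = cD K s.

(* [std_mx b] with its size separated from [b]. *)
Definition stdm m (b : seq int) : 'M[RUV]_m.+1 := \matrix_(i, j)
  if (j == i.+1 :> nat) && (sparam b j < 0) then svar j ^+ `|sparam b j|%N
  else if (i == j.+1 :> nat) && (0 < sparam b i) then svar i ^+ `|sparam b i|%N
  else 0.

(** Dualizing reverses all arrows, that is, changes the signs of all letters. *)
Lemma stdm_tr m b : stdm m (map -%R b) = (stdm m b)^T.
Proof.
have pN k : sparam (map -%R b) k = - sparam b k.
  rewrite /sparam; have [lt_k|le_k] := ltnP k.-1 (size b).
    by rewrite (nth_map 0).
  by rewrite !nth_default ?size_map ?oppr0.
apply/matrixP=> i j; rewrite !mxE !pN oppr_lt0 oppr_gt0 !abszN.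
have [ij|] := eqVneq (i : nat) j.+1; have [ji|] := eqVneq (j : nat) i.+1 => //=.
by exfalso; lia.
Qed.

Lemma svarE k : svar k = uvar (odd k). Proof. by []. Qed.

Lemma ev_stdm m b s (i j : 'I_m.+1) : ev s (stdm m b i j) =
  ((j == i.+1 :> nat) && (b`_i < 0) && (odd i != s) ||
   (i == j.+1 :> nat) && (0 < b`_j) && (odd j != s))%:R.
Proof.
rewrite mxE /sparam; case: (eqVneq (j : nat) i.+1) => [ji|_] /=.
  have -> : (i == j.+1 :> nat) = false by lia.
  rewrite /= ji /= orbF; case: ltP => [b_lt0|_] /=; last by rewrite raddf0.
  rewrite svarE ev_uvar_exp absz_eq0 (lt_eqF b_lt0) orbF /=.
  by case: s; case: odd.
case: (eqVneq (i : nat) j.+1) => [ij|_] /=; last by rewrite raddf0.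
rewrite ij /=; case: ltP => [b_gt0|_] /=; last by rewrite raddf0.
rewrite svarE ev_uvar_exp absz_eq0 (gt_eqF b_gt0) orbF /=.
by case: s; case: odd.
Qed.

Lemma ev_stdm_mul m b s p (Y : 'M['F_2]_(m.+1, p)) (i : 'I_m.+1) :
  row i (map_mx (ev s) (stdm m b) *m Y) =
    if odd i != s then
      if (i < m)%N && (b`_i < 0) then row (inord i.+1) Y else 0
    else if (0 < i)%N && (0 < b`_i.-1) then row (inord i.-1) Y else 0.
Proof.
have eq1 (k : 'I_m.+1) : (forall j, map_mx (ev s) (stdm m b) i j = (j == k)%:R) ->
    row i (map_mx (ev s) (stdm m b) *m Y) = row k Y.
  move=> ik; rewrite row_mul [row k Y]rowE; congr (_ *m _).
  by apply/rowP=> j; rewrite [LHS]mxE ik mxE eqxx.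
have eq0 : (forall j, map_mx (ev s) (stdm m b) i j = 0) ->
    row i (map_mx (ev s) (stdm m b) *m Y) = 0.
  move=> ik; rewrite row_mul; apply/rowP=> j; rewrite !mxE big1 // => k _.
  by rewrite [row _ _ _ _]mxE ik mul0r.
have mapE j : map_mx (ev s) (stdm m b) i j = ev s (stdm m b i j) by rewrite mxE.
have lt_m (j : 'I_m.+1) := ltn_ord j.
case: ifP => odd_s; case: ifP => [/andP[lt_i bi]|nlt];
  [apply: eq1 | apply: eq0 | apply: eq1 | apply: eq0].
- move=> j; rewrite mapE ev_stdm bi odd_s !andbT -val_eqE /= inordK ?ltnS //.
  case: eqP => [//|_] /=; case: (i =P j.+1 :> nat) => //= ij.
  by move: odd_s; rewrite ij /= => /negbTE; case: (s) (odd j) => [] []; rewrite ?andbF.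
- move=> j; rewrite mapE ev_stdm odd_s andbT.
  have := lt_m j; case: (j =P i.+1 :> nat) => [->|_ _] /=.
    rewrite ltnS => lt_i; move: nlt; rewrite lt_i /= => ->.
    by have -> : (nat_of_ord i == i.+2) = false by lia.
  case: (i =P j.+1 :> nat) => //= ij.
  by move: odd_s; rewrite ij /= => /negbTE; case: (s) (odd j) => [] []; rewrite ?andbF.
- move=> j; rewrite mapE ev_stdm odd_s !andbF /= -val_eqE /= inordK; last first.
    by have := lt_m i; lia.
  case: (i =P j.+1 :> nat) => [ij|nij] /=; last first.
    by have -> : (nat_of_ord j == i.-1) = false by lia.
  rewrite ij /= in bi; rewrite bi ij /= eqxx /=.
  by move: odd_s; rewrite ij /=; case: (s) (odd j) => [] [].
- move=> j; rewrite mapE ev_stdm odd_s !andbF /=.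
  case: (i =P j.+1 :> nat) => //= ij; rewrite ij /= in nlt odd_s.
  by rewrite nlt.
Qed.

Lemma dg_std_gr b e0 (i : 'I_(size b).+1) :
  dg true e0 b i - std_gr i = e0 - std_gr (b := b) ord0.
Proof.
case: i => i; elim: i => [|i IH] lt_i.
  by rewrite /= dg0; congr (_ - std_gr _); apply: val_inj.
rewrite -(IH (ltnW lt_i)) /= dgS //.
have := @std_grS b (Ordinal (ltnW lt_i)) (Ordinal lt_i) erefl.
rewrite /std_step /step_deg /sparam /= => stE.
by case: odd stE => /=; rewrite /sh; bd.
Qed.

Lemma stdm_hom m b e0 (bm : size b = m) (i k : 'I_m.+1) :
  homogR (dg true e0 b i - dg true e0 b k - (1, 1)) (stdm m b i k).
Proof.
case: m / bm i k => i k.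
have -> : dg true e0 b i - dg true e0 b k - (1, 1) = - (1, 1) + std_gr i - std_gr k.
  by have := dg_std_gr e0 i; have := dg_std_gr e0 k; bd.
exact: std_mx_deg.
Qed.

(** On each side a generator meets at most one arrow. Its image is the lift that the letter
    provides, or the differential of this lift; the two ends without an arrow get [z] and [z']. *)
Lemma strand_sides m b e0 z : size b = m -> ~~ odd m -> 0 \notin b -> strand K e0 b z ->
  exists Y : bool -> 'M['F_2]_(m.+1, n),
  [/\ row 0 (Y false) = z,
    forall s (i : 'I_m.+1), fil K s (dg true e0 b i) (row i (Y s)),
    forall i : 'I_m.+1, lead K (dg true e0 b i) (row i (Y true)) =
      lead K (dg true e0 b i) (row i (Y false))
    & forall s, Y s *m cD K s = map_mx (ev s) (stdm m b) *m Y s].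
Proof.
move=> <- b_even b0 [X [ze dz zX Xrel [z' [ze' dz' zX']]]].
have /choice[w wP] i : exists w, (i < size b)%N ->
    let e := dg true e0 b i in let e' := dg true e0 b i.+1 in
    let s := ~~ odd i in let dw := w *m cD K s in
    if b`_i < 0 then
      [/\ fil K s e w, fil K s e' dw, lead K e w = X i & lead K e' dw = X i.+1]
    else
      [/\ fil K s e' w, fil K s e dw, lead K e' w = X i.+1 & lead K e dw = X i].
  have [/Xrel|] := boolP (i < size b)%N; last by exists 0.
  by rewrite /letter; case: ifP => _ [w wP]; exists w.
pose next s i := if (i < size b)%N then if b`_i < 0 then w i else w i *m cD K s else z'.
pose prev s i := if i is i'.+1 then if b`_i' < 0 then w i' *m cD K s else w i' else z.
pose y s i := if odd i != s then next s i else prev s i.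
have yP s i : (i <= size b)%N ->
    fil K s (dg true e0 b i) (y s i) /\ lead K (dg true e0 b i) (y s i) = X i.
  rewrite /y /next /prev; case: ifP => [odd_s le_ib|/negbFE/eqP <-].
    have sE : s = ~~ odd i by case: (s) (odd i) odd_s => [] [].
    case: ltnP => [lt_ib|le_bi].
      by have := wP i lt_ib; rewrite /= sE; case: ifP => _ [].
    have iE : i = size b by apply/eqP; rewrite eqn_leq le_ib.
    by rewrite sE iE (negPf b_even).
  case: i => [|i] lt_ib; first by rewrite dg0.
  by have := wP i lt_ib; rewrite /=; case: ifP => _ [].
have yD s i : (i <= size b)%N -> y s i *m cD K s =
    if odd i != s then if (i < size b)%N && (b`_i < 0) then y s i.+1 else 0
    else if (0 < i)%N && (0 < b`_i.-1) then y s i.-1 else 0.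
  rewrite /y; case: ifP => [odd_s le_ib|odd_s le_ib].
    have sE : s = ~~ odd i by case: (s) (odd i) odd_s => [] [].
    rewrite /= -sE eqxx /= /next; case: ltnP => [lt_ib|le_bi] /=.
      by case: ifP => // _; rewrite diffK.
    have iE : i = size b by apply/eqP; rewrite eqn_leq le_ib.
    by rewrite sE iE (negPf b_even).
  have {odd_s} sE : s = odd i by apply/esym/eqP/negbFE.
  case: i le_ib sE => [|i] lt_ib sE /=; first by rewrite sE.
  have bi : b`_i != 0 by apply: contraNneq b0 => <-; apply: mem_nth.
  rewrite sE /= /next lt_ib; case: ltgtP bi => // _ _; last first.
    by case: odd.
  by rewrite diffK.
have rowY s i : row i (\matrix_(i < (size b).+1) y s i) = y s i by rewrite rowK.
exists (fun s => \matrix_(i < (size b).+1) y s i); split=> [|s i|i|s].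
- by rewrite rowK.
- by rewrite rowK; apply: (yP s i _).1; rewrite -ltnS.
- by rewrite !rowK (yP true i _).2 ?(yP false i _).2 // -ltnS.
- apply/row_matrixP=> i; have le_ib : (i <= size b)%N by rewrite -ltnS.
  rewrite ev_stdm_mul row_mul !rowK yD //.
  case: ifP => _; case: ifP => // /andP[lt_i _].
    by rewrite inordK ?ltnS.
  by rewrite inordK //; have := ltn_ord i; lia.
Qed.

(** The two sides have equal leads, so they glue to homogeneous entries by [hliftP]; the chain map
    identity can be checked on each side. *)
Lemma strand_mx m b e0 z : size b = m -> ~~ odd m -> 0 \notin b -> strand K e0 b z ->
  exists Y : 'M[RUV]_(m.+1, n),
  [/\ forall (i : 'I_m.+1) j, homogR (dg true e0 b i - cgr K j) (Y i j),
    Y *m A = stdm m b *m Y & map_mx (ev false) (row 0 Y) = z].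
Proof.
move=> bm m_even b0 zb.
have [y [y0 ye yy yD]] := strand_sides bm m_even b0 zb.
pose Y := \matrix_(i < m.+1, j < n)
  hlift (dg true e0 b i - cgr K j) (y true i j) (y false i j).
have YP (i : 'I_m.+1) (j : 'I_n) : homogR (dg true e0 b i - cgr K j) (Y i j) /\
    forall s, ev s (Y i j) = y s i j.
  rewrite mxE; apply: (hliftP (f := fun s => y s i j)) => [s|gj].
    move=> yij; have := ye s i j; rewrite mxE => /(_ yij)[k gj].
    by exists k; bd.
  have gj' : cgr K j = dg true e0 b i by bd.
  by have /rowP/(_ j) := yy i; rewrite !mxE !asboolT.
have YE s : map_mx (ev s) Y = y s.
  by apply/matrixP=> i j; rewrite mxE (YP i j).2.
exists Y; split=> [i j||]; first exact: (YP i j).1.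
  apply/matrixP=> i j.
  apply: (homogR_eq (d := dg true e0 b i - (1, 1) - cgr K j)) => [||s].
  - rewrite mxE; apply: homogR_sum => k _.
    have -> : dg true e0 b i - (1, 1) - cgr K j =
      dg true e0 b i - cgr K k + (cgr K k - (1, 1) - cgr K j) by bd.
    exact: homogRM (YP i k).1 (Ahom k j).
  - rewrite mxE; apply: homogR_sum => k _.
    have -> : dg true e0 b i - (1, 1) - cgr K j =
      dg true e0 b i - dg true e0 b k - (1, 1) + (dg true e0 b k - cgr K j) by bd.
    exact: homogRM (stdm_hom e0 bm i k) (YP k j).1.
  transitivity (map_mx (ev s) (Y *m A) i j); first by rewrite [RHS]mxE.
  by rewrite map_mxM YE AD yD -YE -map_mxM [LHS]mxE.
by rewrite map_row YE.
Qed.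

End Matrices.

(** * Homology classes *)

Section Classes.
Variable C : bicomplex.
Local Notation CV := 'rV[RUV]_(rank C).
Implicit Types x y : CV.

Definition cycU x : Prop := diff C x \in mults U CV.

Lemma cls_subproof x : cycU x -> pim (mults U CV) x \in is_cycle (modr_map U (diff C)).
Proof.
move=> dx; rewrite unfold_in modr_mapE -(raddf0 (pim (mults U CV))).
by apply/eqP/pim_eqP; rewrite subr0.
Qed.

Definition cls x (dx : cycU x) : Htf U V C :=
  pim (torsion V (Hmod U C)) (pim (is_boundary _) (Cycle (cls_subproof dx))).

Lemma cls_surj (q : Htf U V C) : exists x (dx : cycU x), q = cls dx.
Proof.
have [c cE] : exists c, reprm q = pim (is_boundary (modr_map U (diff C))) c.
  by exists (reprm (reprm q)); rewrite reprmK.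
have [x xE] : exists x, cycle_val c = pim (mults U CV) x.
  by exists (reprm (cycle_val c)); rewrite reprmK.
have dx : cycU x.
  have := valP c; rewrite /= xE unfold_in modr_mapE -(raddf0 (pim (mults U CV))).
  by move=> /eqP/pim_eqP; rewrite subr0.
exists x, dx; rewrite -[q]reprmK cE; congr (pim _ (pim _ _)).
by apply: val_inj; rewrite /= xE.
Qed.

Lemma clsP x y (dx : cycU x) (dy : cycU y) : cls dx = cls dy <->
  exists k w t, V ^+ k *: (x - y) = diff C w + U *: t.
Proof.
split.
  move/pim_eqP/torsionP=> [k /eqP]; rewrite -raddfB -linearZ -(raddf0 (pim _)).
  move=> /eqP/pim_eqP/is_boundaryP[w]; rewrite -[w]reprmK modr_mapE subr0 /=.
  rewrite -raddfB -linearZ /= => /pim_eqP/multsP[t tE].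
  by exists k, (reprm w), t; rewrite -tE [RHS]addrC subrK.
case=> k [w [t xyE]]; apply/pim_eqP/torsionP; exists k.
rewrite -raddfB -linearZ -(raddf0 (pim _)); apply/pim_eqP/is_boundaryP.
exists (pim (mults U CV) w); rewrite modr_mapE subr0 /= -raddfB -linearZ /=.
by apply/pim_eqP/multsP; exists t; rewrite xyE addrAC subrr add0r.
Qed.

Lemma clsD x y (dx : cycU x) (dy : cycU y) (dxy : cycU (x + y)) :
  cls dxy = cls dx + cls dy.
Proof.
rewrite /cls -!raddfD; congr (pim _ (pim _ _)); apply: val_inj.
by rewrite /= raddfD.
Qed.

Lemma clsZ a x (dx : cycU x) (dax : cycU (a *: x)) : cls dax = a *: cls dx.
Proof.
rewrite /cls -!linearZ; congr (pim _ (pim _ _)); apply: val_inj.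
by rewrite /= linearZ.
Qed.

Lemma cycUZ a x : cycU x -> cycU (a *: x).
Proof.
case/multsP=> y xE; apply/multsP; exists (a *: y).
by rewrite linearZ /= xE !scalerA mulrC.
Qed.

Lemma cycUD x y : cycU x -> cycU y -> cycU (x + y).
Proof.
move=> /multsP[x' xE] /multsP[y' yE]; apply/multsP; exists (x' + y').
by rewrite linearD xE yE scalerDr.
Qed.

End Classes.

Lemma cycU_map C D (f : chain_map C D) x : cycU x -> cycU (f x).
Proof. by rewrite /cycU -chain_mapP; apply: mults_map. Qed.

Lemma Htf_map_cls C D (f : chain_map C D) x (dx : cycU x) :
  Htf_map U V f (cls dx) = cls (cycU_map f dx).
Proof.
rewrite /Htf_map mod_torsion_mapE homology_mapE; congr (pim _ (pim _ _)).
by apply: val_inj; rewrite /= modr_mapE.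
Qed.

Section PolynomialModule.
Variables (M : lmodType RUV) (f : {additive M -> {poly 'F_2}}).
Hypothesis fV : forall h, f (V *: h) = 'X * f h.

Lemma poly_module_scale p h : f (poly_var false p *: h) = p * f h.
Proof.
elim/poly_ind: p => [|p c IH]; first by rewrite raddf0 scale0r raddf0 mul0r.
rewrite poly_var_MXaddC scalerDl raddfD mulrC -scalerA fV IH mulrDl.
congr (_ + _); first by rewrite mulrA (mulrC 'X).
case: (F2_cases c) => ->; rewrite ?rmorph0 ?rmorph1 ?scale0r ?scale1r ?raddf0.
  by rewrite mul0r.
by rewrite mul1r.
Qed.

End PolynomialModule.

(** Both modules are free of rank one over the polynomials in [V], and [phi] maps a generator to a
    generator. *)
Lemma poly_module_bij (M M' : lmodType RUV) (f : {additive M -> {poly 'F_2}})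
    (f' : M' -> {poly 'F_2}) (phi : {linear M -> M'}) u :
    bijective f -> (forall h, f (V *: h) = 'X * f h) ->
    bijective f' -> (forall p h, f' (poly_var false p *: h) = p * f' h) ->
    f u = 1 -> f' (phi u) = 1 ->
  bijective phi.
Proof.
move=> fbij fV [g' f'K g'K] f'V fu f'u; have finj := bij_inj fbij.
have phiE h : f' (phi h) = f h.
  have -> : h = poly_var false (f h) *: u.
    by apply: finj; rewrite poly_module_scale // fu mulr1.
  by rewrite linearZ /= f'V f'u mulr1 poly_module_scale // fu mulr1.
apply: (eq_bij (f := g' \o f)) => [|h]; last by rewrite /= -phiE f'K.
by apply: bij_comp fbij; exists f'.
Qed.

(** * The tower of a knot-like complex *)

Section Tower.
Variable C : bicomplex.
Let n := rank C.

Definition cmx : 'M[RUV]_n := lin1_mx (diff C).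

Lemma diffE x : diff C x = x *m cmx.
Proof. by rewrite mul_rV_lin1. Qed.

Lemma cmx_sq : cmx *m cmx = 0.
Proof. by apply/row_matrixP=> i; rewrite row0 rowE mulmxA -!diffE diff_sq. Qed.

Lemma cmx_hom i j : homogR (gr i - (1, 1) - gr j) (cmx i j).
Proof.
suff ei : homogeneous (@gr C) (gr i) (delta_mx 0 i).
  by have := diff_deg ei j; rewrite diffE -rowE mxE.
move=> k; rewrite mxE eqxx /=; case: (k =P i) => [->|_]; last by left.
by right; exists 0%N, 0%N; rewrite mulr1; split=> //; bd.
Qed.

Fact gc_deg s i j : map_mx (ev s) cmx i j != 0 ->
  exists k : nat, gr j = gr i - (1, 1) + sh s k.
Proof.
rewrite mxE; case/homogR_monomial: (cmx_hom i j) => [->|[s' [k [gij ->]]]].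
  by rewrite raddf0 eqxx.
rewrite ev_uvar_exp; case: (s =P s') => [->|_] /=; first by move=> _; exists k; bd.
case: k gij => [|k] gij; last by rewrite eqxx.
by move=> _; exists 0%N; bd.
Qed.

Fact gc_sq s : map_mx (ev s) cmx *m map_mx (ev s) cmx = 0.
Proof. by rewrite -map_mxM cmx_sq map_mx0. Qed.

Fact gc_lead i j : gr j = gr i - (1, 1) ->
  map_mx (ev true) cmx i j = map_mx (ev false) cmx i j.
Proof.
move=> gij; rewrite [LHS]mxE [RHS]mxE.
case/homogR_monomial: (cmx_hom i j) => [->|[s [k [gk ->]]]].
  by rewrite !raddf0.
have -> : k = 0%N by bd.
by rewrite !ev_uvar_exp !orbT.
Qed.

Definition gc : gcplx n := GCplx gc_deg gc_sq gc_lead.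

End Tower.

(* The element of bidegree [e] over [RUV] corresponding to [z] in [fil false e]. *)
Definition homogenize n (K : gcplx n) e (z : 'rV['F_2]_n) : 'rV[RUV]_n :=
  \row_j hlift (e - cgr K j) (lead K e z 0 j) (z 0 j).

Lemma homogenizeP n (K : gcplx n) e z : fil K false e z ->
  (forall j, homogR (e - cgr K j) (homogenize K e z 0 j)) /\
  map_mx (ev false) (homogenize K e z) = z.
Proof.
move=> ze.
have hzP j := hliftP (d := e - cgr K j)
  (f := fun s : bool => if s then lead K e z 0 j else z 0 j).
have {}hzP j : homogR (e - cgr K j) (homogenize K e z 0 j) /\
    forall s : bool, ev s (homogenize K e z 0 j) = if s then lead K e z 0 j else z 0 j.
  rewrite mxE; apply: hzP => [s|gj].
    case: s => [/restrE gj|/ze[k gj]]; last by exists k; bd.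
    by exists 0%N; bd.
  by rewrite mxE asboolT //; bd.
split=> [j|]; first by case: (hzP j).
by apply/rowP=> j; rewrite mxE (hzP j).2.
Qed.

Lemma multsUP n (x : 'rV[RUV]_n) : x \in mults U 'rV_n <-> map_mx (spec false) x = 0.
Proof.
split=> [/multsP[y ->]|x0].
  by apply/rowP=> j; rewrite !mxE rmorphM /= (spec_uvar false true) mul0r.
have /choice[t tE] j : exists t, x 0 j = U * t.
  by apply: spec_ker; move/rowP/(_ j): x0; rewrite !mxE.
by apply/multsP; exists (\row_j t j); apply/rowP=> j; rewrite !mxE tE.
Qed.

Section Homology.
Variable C : bicomplex.
Local Notation K := (gc C).
Local Notation A := (cmx C).

Lemma cycUP x : cycU (C := C) x <-> map_mx (spec false) (x *m A) = 0.
Proof. by rewrite /cycU diffE; apply: multsUP. Qed.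

Definition vcycle e (z : 'rV['F_2]_(rank C)) := fil K false e z /\ z *m cD K false = 0.

Definition vbdry (z : 'rV['F_2]_(rank C)) := exists w, z = w *m cD K false.

Lemma cycU_homogenize e z : vcycle e z -> cycU (C := C) (homogenize K e z).
Proof.
move=> [ze dz]; have [hz evz] := homogenizeP ze; apply/cycUP/rowP=> j.
rewrite mxE [RHS]mxE; apply: (homogR_spec0 (d := e - (1, 1) - cgr K j)).
  rewrite mxE; apply: homogR_sum => i _.
  have -> : e - (1, 1) - cgr K j = e - cgr K i + (cgr K i - (1, 1) - cgr K j) by bd.
  exact: homogRM (hz i) (cmx_hom i j).
transitivity (map_mx (ev false) (homogenize K e z *m A) 0 j); first by rewrite [RHS]mxE.
by rewrite map_mxM evz dz mxE.
Qed.

Lemma cls_eq_vbdry x y (dx : cycU x) (dy : cycU y) : cls dx = cls dy ->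
  vbdry (map_mx (ev false) x - map_mx (ev false) y).
Proof.
move=> /clsP[k [w [t /(congr1 (map_mx (ev false)))]]].
rewrite diffE map_mxZ map_mxB map_mxD map_mxZ map_mxM /= rmorphXn /=.
rewrite (ev_uvar false false) (ev_uvar false true) expr1n scale1r scale0r addr0.
by exists (map_mx (ev false) w).
Qed.

Lemma cls_spec x y (dx : cycU (C := C) x) (dy : cycU (C := C) y) :
  map_mx (spec false) x = map_mx (spec false) y -> cls dx = cls dy.
Proof.
move=> xy; apply/clsP; exists 0%N, 0.
have /multsUP/multsP[t tE] : map_mx (spec false) (x - y) = 0 by rewrite map_mxB xy subrr.
by exists t; rewrite expr0 scale1r linear0 add0r.
Qed.

Lemma homogeneous_homogenize e z : fil K false e z ->
  homogeneous (@gr C) e (homogenize K e z).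
Proof. by move=> /homogenizeP[hz _] j; apply: hz. Qed.

Hypothesis hC : knot_like C.

(** The homogenization of [z] represents a homogeneous class; were it torsion, setting [V] to 1
    would make [z] a boundary. *)
Lemma nonvbdry_deg e z : vcycle e z -> ~ vbdry z -> e.1 = 0.
Proof.
move=> zc zB; have [_ degU _ _] := hC; have hz := cycU_homogenize zc.
apply: (degU e (pim (is_boundary _) (Cycle (cls_subproof hz)))).
  exists (homogenize K e z), (Cycle (cls_subproof hz)); split=> //.
  exact: homogeneous_homogenize zc.1.
apply/negP=> tors_z; apply: zB.
have d0 : cycU (C := C) 0 by rewrite /cycU linear0 rpred0.
have -> : z = map_mx (ev false) (homogenize K e z) - map_mx (ev false) 0.
  by rewrite map_mx0 subr0 (homogenizeP zc.1).2.
apply: (cls_eq_vbdry (dx := hz) (dy := d0)); apply/pim_eqP.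
rewrite [X in _ - X](_ : _ = 0) ?subr0 //.
rewrite -(raddf0 (pim (is_boundary (modr_map U (diff C))))); congr pim.
by apply: val_inj; rewrite /= raddf0.
Qed.

End Homology.

Lemma poly_F2_mul_eq1 (p q : {poly 'F_2}) : p * q = 1 -> p = 1.
Proof.
move=> pq1; have p0 : p != 0.
  by apply: contra_eq_neq pq1 => ->; rewrite mul0r eq_sym oner_eq0.
have q0 : q != 0 by apply: contra_eq_neq pq1 => ->; rewrite mulr0 eq_sym oner_eq0.
have := size_mul p0 q0; rewrite pq1 size_poly1 => sz.
have /eqP/size_poly1P[c c0 ->] : size p = 1%N.
  move: p0 q0 sz; rewrite -!size_poly_gt0.
  by case: (size p) => [|[|a]] //; case: (size q) => [|b] //; rewrite addnS.
by rewrite (F2_neq0 c0).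
Qed.

Section TowerClass.
Variable C : bicomplex.
Local Notation K := (gc C).
Local Notation A := (cmx C).
Variable f : {additive Htf U V C -> {poly 'F_2}}.
Hypothesis fbij : bijective f.
Hypothesis fV : forall h, f (V *: h) = 'X * f h.

(** Take a representative [x] of the class over 1. If it became a boundary at [V = 1], then modulo
    [U] it would be a boundary plus [V - 1] times a cycle, and 1 would be a multiple of ['X - 1]. *)
Lemma nonvbdry_ex : exists y, y *m cD K false = 0 /\ ~ vbdry (C := C) y.
Proof.
have [g fK gK] := fbij; have [x [dx gE]] := cls_surj (g 1).
have fx : f (cls dx) = 1 by rewrite -gE gK.
exists (map_mx (ev false) x); split.
  rewrite -map_mxM; apply/rowP=> j.
  have /cycUP/rowP/(_ j) := dx; rewrite mxE [RHS]mxE => xA.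
  by rewrite mxE [RHS]mxE /= /ev xA horner0.
case=> w xw; pose x' := x - map_mx cst w *m A.
have x'1 j : root (spec false (x' 0 j)) 1.
  rewrite /root -/(ev false _); suff -> : ev false (x' 0 j) = 0 by [].
  have -> : ev false (x' 0 j) = map_mx (ev false) x' 0 j by rewrite [RHS]mxE.
  rewrite map_mxB map_mxM xw -map_mx_comp map_mx_id ?subrr ?mxE // => a.
  by rewrite /= /ev spec_cst hornerC.
have /choice[q qE] j : exists q, spec false (x' 0 j) = q * ('X - 1%:P).
  by have /factor_theorem[q] := x'1 j; exists q.
pose x2 := \row_j poly_var false (q j).
have x'E : map_mx (spec false) x' = ('X - 1) *: map_mx (spec false) x2.
  by apply/rowP=> j; rewrite [LHS]mxE qE !mxE spec_poly_var mulrC.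
have dx2 : cycU (C := C) x2.
  apply/cycUP; have : ('X - 1) *: map_mx (spec false) (x2 *m A) = 0.
    rewrite map_mxM scalemxAl -x'E -map_mxM /x' mulmxBl -mulmxA cmx_sq mulmx0 subr0.
    exact/cycUP.
  move=> /matrixP x0; apply/rowP=> j; have := x0 0 j.
  rewrite mxE [RHS]mxE => /eqP; rewrite mulf_eq0 -polyC1 polyXsubC_eq0 => /eqP->.
  by rewrite mxE.
have fE : f (cls dx) = 'X * f (cls dx2) - f (cls dx2).
  have dVx2 := cycUZ V dx2; rewrite -fV -clsZ -raddfB.
  have dNx2 := cycUZ (-1) dx2; have d' := cycUD dVx2 dNx2.
  suff -> : cls dx = cls d' by rewrite (clsD dVx2 dNx2) (clsZ dx2 dNx2) scaleN1r.
  apply/clsP; have /multsUP/multsP[t tE] : map_mx (spec false) (x' - (V - 1) *: x2) = 0.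
    by rewrite map_mxB map_mxZ x'E rmorphB /= rmorph1 (spec_uvar false false) subrr.
  exists 0%N, (map_mx cst w), t; rewrite expr0 scale1r -tE diffE scaleN1r.
  by rewrite /x' scalerBl scale1r addrA addrCA subrr addr0.
move: fE; rewrite fx => /(congr1 (fun p => p.[1])).
by rewrite hornerD hornerN hornerM hornerX mul1r subrr hornerC => /eqP; rewrite oner_eq0.
Qed.

Lemma vbdryD y y' : vbdry (C := C) y -> vbdry (C := C) y' -> vbdry (C := C) (y + y').
Proof. by move=> [w ->] [w' ->]; exists (w + w'); rewrite mulmxDl. Qed.

(** The components on the lines of a cycle are cycles; if all were boundaries, so would be their
    sum. *)
Lemma nonvbdry_line_ex : exists e z, vcycle (C := C) e z /\ ~ vbdry z.
Proof.
have [y [dy yB]] := nonvbdry_ex; apply: contrapT => noz; apply: yB.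
pose part (r : seq 'I_(rank C)) :=
  restr (fun i => exists2 j, j \in r & line K false (gr j) i) y.
have lineB j : vbdry (restr (line K false (gr j)) y).
  apply: contrapT => nB; apply: noz.
  have [k kP] := fil_small K false (gr j).
  exists (gr j - sh false k), (restr (line K false (gr j)) y); split=> //; split.
    by apply: kP; [bd | apply: restr_id => i /restrE].
  by rewrite (@line_diff _ K false _ (gr j - (1, 1))) // dy linear0.
have partB r : vbdry (part r).
  elim: r => [|j r IH].
    exists 0; rewrite mul0mx; apply/rowP=> i; rewrite !mxE.
    by case: asboolP => // -[].
  (* Several generators may lie on one line, which must be added only once. *)
  have [[j' j'r [k kE]]|njr] := pselect (exists2 j', j' \in r & line K false (gr j') j).
    suff -> : part (j :: r) = part r by [].
    apply/rowP=> i; rewrite !mxE; congr (if _ then _ else _); apply: asbool_equiv_eq.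
    split=> -[l]; last by move=> lr li; exists l; rewrite // inE lr orbT.
    rewrite inE => /orP[/eqP->|lr li]; last by exists l.
    by case=> m mE; exists j' => //; exists (k + m); bd.
  suff -> : part (j :: r) = restr (line K false (gr j)) y + part r by apply: vbdryD.
  apply/rowP=> i; rewrite !mxE.
  have [li|nli] := pselect (line K false (gr j) i).
    rewrite asboolT; last by exists j; rewrite ?mem_head.
    rewrite asboolT // asboolF ?addr0 // => -[j' j'r [m mE]].
    by case: li => m' m'E; apply: njr; exists j' => //; exists (m - m'); bd.
  rewrite (asboolF nli) add0r; congr (if _ then _ else _).
  apply: asbool_equiv_eq; split=> -[l].
    by rewrite inE => /orP[/eqP->//|lr li]; exists l.
  by move=> lr li; exists l; rewrite // inE lr orbT.
suff <- : part (enum 'I_(rank C)) = y by [].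
by apply: restr_id => j _; exists j; rewrite ?mem_enum //; exists 0; bd.
Qed.

Lemma tower_max : exists e0, (exists z, vcycle (C := C) e0 z /\ ~ vbdry z) /\
  forall e z, e = e0 + sh false 1 -> vcycle (C := C) e z -> vbdry z.
Proof.
have [e [z [zc zB]]] := nonvbdry_line_ex.
pose P (k : nat) := `[< exists z, vcycle (C := C) (e + sh false k) z /\ ~ vbdry z >].
have [m mP] := fil_big K false e.
have Pm k : P k -> (k <= m)%N.
  move=> /asboolP[x [[xe _] xB]]; rewrite leqNgt; apply/negP=> lt_mk; case: xB.
  exists 0; rewrite mul0mx; apply: mP erefl _.
  by apply: (fil_shift (k := (k - m)%N)) xe; bd.
have P0 : exists k, P k.
  by exists 0%N; apply/asboolP; exists z; have -> : e + sh false 0%N = e by bd.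
case: (ex_maxnP P0 Pm) => k /asboolP[x [xc xB]] max_k.
exists (e + sh false k); split=> [|e' z' e'E z'c]; first by exists x.
apply: contrapT => z'B; suff /max_k : P k.+1 by rewrite ltnn.
apply/asboolP; exists z'; split=> //.
by have -> : e + sh false k.+1 = e' by bd.
Qed.

Variable e0 : bideg.
Hypothesis e0_max : forall e z, e = e0 + sh false 1 -> vcycle (C := C) e z -> vbdry z.

(** Subtracting a boundary with the same lead would leave a cycle divisible by [V], a boundary by
    [e0_max]. *)
Lemma nonvbdry_not_tors z : vcycle (C := C) e0 z -> ~ vbdry z ->
  ~ tors K false e0 (lead K e0 z).
Proof.
move=> [ze dz] zB [w we wz]; apply: zB.
have zwB : vbdry (z - w *m cD K false).
  apply: (e0_max erefl); split; last by rewrite mulmxBl dz diffK subr0.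
  apply: fil_lead0 erefl _ _; last by rewrite leadB wz subrr.
  exact: filB.
have -> : z = z - w *m cD K false + w *m cD K false by rewrite subrK.
by apply: vbdryD => //; exists w.
Qed.

(* A dual cocycle that is 1 on [z] gives a map from the homology modulo torsion to the
   polynomials sending the class of [z] to 1; so [f] sends this class to a unit. *)
Lemma tower_cls z (zc : vcycle (C := C) e0 z) : ~ vbdry z ->
  f (cls (cycU_homogenize zc)) = 1.
Proof.
move=> zB; have zT := nonvbdry_not_tors zc zB; have [ze dz] := zc.
have [c [ce dc _ cz]] := cocycle_sep (tors_additive K false e0) (fun _ => id)
  (@lead_conc _ K e0 z) zT.
rewrite (lead_pair erefl ze ce) in cz.
pose k : 'cV[RUV]_(rank C) := (homogenize (dual K) (- e0) c)^T.
have [hc evc] := homogenizeP ce; have [hz evz] := homogenizeP ze.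
have Ak : map_mx (spec false) (A *m k) = 0.
  apply/colP=> i; rewrite mxE [RHS]mxE.
  apply: (homogR_spec0 (d := gr i - (1, 1) - e0)).
    rewrite mxE; apply: homogR_sum => j _.
    have -> : gr i - (1, 1) - e0 = gr i - (1, 1) - gr j + (- e0 - cgr (dual K) j).
      by rewrite /=; bd.
    by apply: homogRM (cmx_hom i j) _; rewrite mxE; apply: hc.
  transitivity (map_mx (ev false) (A *m k) i 0); first by rewrite [RHS]mxE.
  rewrite map_mxM /k -map_trmx evc -[map_mx _ A]trmxK -trmx_mul.
  by have -> : c *m (map_mx (ev false) A)^T = 0 by []; rewrite !mxE.
have zk : homogenize K e0 z *m k = 1%:M.
  apply/matrixP=> i j; rewrite !ord1 [RHS]mxE eqxx; apply: (homogR0_eq1 (s := false)).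
    rewrite mxE; apply: homogR_sum => l _.
    have -> : 0 = e0 - gr l + (- e0 - cgr (dual K) l) by rewrite /=; bd.
    by apply: homogRM (hz l) _; rewrite mxE; apply: hc.
  transitivity (map_mx (ev false) (homogenize K e0 z *m k) 0 0); first by rewrite [RHS]mxE.
  by rewrite map_mxM /k -map_trmx evc evz cz mxE.
have [g fK gK] := fbij; have [x [dx gE]] := cls_surj (g 1).
(* The class of [z] is [p] times that of [x]. Pairing with [k] modulo [U] kills boundaries, and the
   power of [V] from torsion cancels. *)
set p := f _; apply: (@poly_F2_mul_eq1 p (map_mx (spec false) (x *m k) 0 0)).
have dpx := cycUZ (poly_var false p) dx.
have : cls (cycU_homogenize zc) = cls dpx.
  by apply: (bij_inj fbij); rewrite clsZ -gE poly_module_scale // gK mulr1.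
move=> /clsP[l [w [t]]].
move=> /(congr1 (fun y => map_mx (spec false) (y *m k))).
rewrite diffE mulmxDl -mulmxA -!scalemxAl mulmxBl -scalemxAl.
rewrite map_mxD map_mxM Ak mulmx0 add0r map_mxZ [in RHS]map_mxZ /=.
rewrite (spec_uvar false true) scale0r map_mxB zk map_mx1 map_mxZ /= spec_poly_var.
move=> /matrixP/(_ 0 0); rewrite mxE [RHS]mxE => /eqP; rewrite mulf_eq0 rmorphXn /=.
rewrite (spec_uvar false false) expf_eq0 polyX_eq0 andbF /=.
have subE (a b : 'M[{poly 'F_2}]_1) : (a - b) 0 0 = a 0 0 - b 0 0 by rewrite !mxE.
rewrite subE [1%:M _ _]mxE eqxx subr_eq0 => /eqP pE.
by rewrite -[RHS]/(true%:R) pE [RHS]mxE.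
Qed.

End TowerClass.

(** * Standard complexes *)

Section StandardTower.
Variable b : seq int.
Local Notation S := (standard_complex b).
Local Notation m := (size b).
Local Notation SV := (map_mx (spec false) (std_mx b)).

Lemma spec_std_mx (i j : 'I_m.+1) : SV i j =
  if (j == i.+1 :> nat) && (b`_i < 0) && odd i then 'X^`|b`_i|
  else if (i == j.+1 :> nat) && (0 < b`_j) && odd j then 'X^`|b`_j| else 0.
Proof.
have specE k c : c != 0 -> spec false (svar k ^+ `|c|) = if odd k then 0 else 'X^`|c|.
  move=> c0; rewrite rmorphXn svarE /= spec_uvar; case: odd => //=.
  by rewrite expr0n absz_eq0 (negPf c0).
rewrite !mxE /sparam; case: (eqVneq (j : nat) i.+1) => [ji|_] /=.
  have -> : (i == j.+1 :> nat) = false by lia.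
  rewrite ji /=; case: ltP => [b_lt0|_] /=; last by rewrite raddf0.
  by rewrite specE ?lt_eqF //=; case: odd.
case: (eqVneq (i : nat) j.+1) => [ij|_] /=; last by rewrite raddf0.
rewrite ij /=; case: ltP => [b_gt0|_] /=; last by rewrite raddf0.
by rewrite specE ?gt_eqF //=; case: odd.
Qed.

Lemma SV_col0 i : SV i ord0 = 0.
Proof. by rewrite spec_std_mx /= andbF. Qed.

Lemma SV_row0 j : SV ord0 j = 0.
Proof. by rewrite spec_std_mx /= andbF. Qed.

Definition ptors (y : 'rV[{poly 'F_2}]_m.+1) := exists (k : nat) w, 'X^k *: y = w *m SV.

Lemma ptorsD y y' : ptors y -> ptors y' -> ptors (y + y').
Proof.
move=> [k [w yE]] [k' [w' y'E]]; exists (k + k')%N, ('X^k' *: w + 'X^k *: w').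
by rewrite mulmxDl -!scalemxAl -yE -y'E !scalerA -!exprD scalerDr addnC.
Qed.

Lemma std_cycUP (x : 'rV[RUV]_(rank S)) :
  cycU (C := S) x <-> map_mx (spec false) x *m SV = 0.
Proof. by rewrite /cycU -map_mxM; apply: multsUP. Qed.

Definition std_val (q : Htf U V S) : {poly 'F_2} :=
  spec false (projT1 (cid (cls_surj q)) 0 ord0).

(** The chosen representative does not matter: modulo [U] no differential involves the first
    generator, and powers of [V] cancel. *)
Lemma std_val_cls x (dx : cycU (C := S) x) : std_val (cls dx) = spec false (x 0 ord0).
Proof.
rewrite /std_val; case: cid => y /= [dy xy].
have [k [w [t]]] := (clsP dx dy).1 xy.
move=> /(congr1 (fun v => map_mx (spec false) v 0 ord0)).
rewrite map_mxZ map_mxB map_mxD map_mxZ map_mxM /= (spec_uvar false true) scale0r addr0.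
rewrite [RHS]mxE big1 => [|i _]; last by rewrite SV_col0 mulr0.
rewrite mxE rmorphXn /= (spec_uvar false false) => /eqP.
rewrite mulf_eq0 expf_eq0 polyX_eq0 andbF /= !mxE subr_eq0 => /eqP->//.
Qed.

Fact std_val_zmod_morphism : zmod_morphism std_val.
Proof.
move=> q q'; have [[x [dx ->]] [x' [dx' ->]]] := (cls_surj q, cls_surj q').
have dN := cycUZ (-1) dx'; have dxx' := cycUD dx dN.
rewrite -[- cls dx']scaleN1r -(clsZ dx' dN) -(clsD dx dN dxx') !std_val_cls.
by rewrite scaleN1r !mxE rmorphB.
Qed.

HB.instance Definition _ := GRing.isZmodMorphism.Build _ _ std_val std_val_zmod_morphism.

Lemma std_valV q : std_val (V *: q) = 'X * std_val q.
Proof.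
have [x [dx ->]] := cls_surj q; have dVx := cycUZ V dx.
by rewrite -(clsZ dx dVx) !std_val_cls mxE rmorphM /= (spec_uvar false false).
Qed.

Lemma cycU_std0 : cycU (C := S) (delta_mx 0 ord0).
Proof.
apply/std_cycUP/rowP=> j; rewrite map_delta_mx -rowE [LHS]mxE [RHS]mxE.
exact: SV_row0.
Qed.

Lemma std_val0 : std_val (cls cycU_std0) = 1.
Proof. by rewrite std_val_cls mxE !eqxx rmorph1. Qed.

Hypothesis b_even : ~~ odd (size b).
Hypothesis b0 : 0 \notin b.

(* Every generator but the first is one end of an arrow of [V]: its coefficient in a
   cycle vanishes, or a power of [V] times it is a boundary. *)
Lemma std_partner (i : 'I_m.+1) : i != ord0 -> exists (p : 'I_m.+1) (c : nat),
  (forall j, SV j p = if j == i then 'X^c else 0) \/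
  (forall j, SV p j = if j == i then 'X^c else 0).
Proof.
have bn0 k : (k < m)%N -> b`_k != 0.
  by move=> lt_k; apply: contraNneq b0 => <-; apply: mem_nth.
move=> i0; have [odd_i|even_i] := boolP (odd i).
  have lt_im : (i < m)%N.
    rewrite ltn_neqAle -ltnS ltn_ord andbT; apply: contraNneq b_even => <-.
    by rewrite odd_i.
  have lt_i1 : (i.+1 < m.+1)%N by [].
  exists (Ordinal lt_i1), (absz b`_i).
  have := bn0 _ lt_im; case: (ltgtP b`_i 0) => // b_i _; [left | right] => j.
    rewrite spec_std_mx /= -val_eqE /=; case: (eqVneq (j : nat) i) => [->|ji] /=.
      by rewrite eqxx b_i odd_i.
    have -> : (i.+1 == j.+1 :> nat) = false by lia.
    have [->|//] := eqVneq (j : nat) i.+2.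
    by rewrite /= odd_i andbF.
  rewrite spec_std_mx /= -val_eqE /=; case: (eqVneq (j : nat) i) => [->|ji] /=.
    have -> : (nat_of_ord i == i.+2) = false by lia.
    by rewrite eqxx b_i odd_i.
  have -> : (i.+1 == j.+1 :> nat) = false by lia.
  by rewrite odd_i /= andbF.
case: i i0 even_i => [[|i] lt_i] //= _; rewrite negbK => odd_i.
have lt_im : (i < m)%N by [].
exists (Ordinal (ltnW lt_i)), (absz b`_i).
have := bn0 _ lt_im; case: (ltgtP b`_i 0) => // b_i _; [right | left] => j.
  rewrite spec_std_mx /= -val_eqE /=; case: (eqVneq (j : nat) i.+1) => [->|ji] /=.
    by rewrite b_i odd_i.
  case: (eqVneq i j.+1) => //= ij.
  by move: odd_i; rewrite ij /= => /negbTE->; rewrite andbF.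
rewrite spec_std_mx /= -val_eqE /=; case: (eqVneq (j : nat) i.+1) => [->|ji] /=.
  have -> : (i == i.+2) = false by lia.
  by rewrite /= b_i odd_i.
case: (eqVneq i j.+1) => //= ij.
by move: odd_i; rewrite ij /= => /negbTE->; rewrite andbF.
Qed.

Lemma std_cycle_ptors (y : 'rV_m.+1) : y *m SV = 0 -> y 0 ord0 = 0 -> ptors y.
Proof.
move=> yS y0; rewrite [y]row_sum_delta; elim/big_ind: _ => [||i _].
- by exists 0%N, 0; rewrite mul0mx scaler0.
- exact: ptorsD.
have [->|/std_partner[p [c [colp|rowp]]]] := eqVneq i ord0.
- by exists 0%N, 0; rewrite y0 scale0r scaler0 mul0mx.
- suff -> : y 0 i = 0 by exists 0%N, 0; rewrite scale0r scaler0 mul0mx.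
  move/rowP/(_ p): yS; rewrite mxE (bigD1 i) //= big1 => [|j ji]; last first.
    by rewrite colp (negPf ji) mulr0.
  rewrite colp eqxx addr0 mxE => /eqP.
  by rewrite mulf_eq0 expf_eq0 polyX_eq0 andbF orbF => /eqP.
exists c, (y 0 i *: delta_mx 0 p); rewrite -scalemxAl -rowE scalerA mulrC -scalerA.
congr (_ *: _); apply/rowP=> j; rewrite mxE [RHS]mxE rowp mxE eqxx /=.
by case: eqP => _; rewrite ?mulr1 ?mulr0.
Qed.

Lemma std_val_inj : injective std_val.
Proof.
apply: raddf_inj => q; have [x [dx ->]] := cls_surj q; rewrite /= std_val_cls => x0.
have /std_cycUP dxS := dx.
have [|k [w kw]] := std_cycle_ptors dxS; first by rewrite mxE.
have d0 := cycUZ 0 dx; rewrite -[RHS](scale0r (cls dx)) -(clsZ dx d0).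
apply/clsP; pose w' := map_mx (poly_var false) w.
have ww' : map_mx (spec false) w' = w.
  by apply/rowP=> j; rewrite !mxE spec_poly_var.
have /multsUP/multsP[t tE] :
    map_mx (spec false) (V ^+ k *: x - w' *m std_mx b) = 0.
  rewrite map_mxB map_mxZ map_mxM ww' -kw rmorphXn /= (spec_uvar false false).
  by rewrite subrr.
by exists k, w', t; rewrite scale0r subr0 -tE /= [RHS]addrC subrK.
Qed.

Lemma std_val_bij : bijective std_val.
Proof.
pose g p : Htf U V S := poly_var false p *: cls cycU_std0.
have gK : cancel g std_val.
  by move=> p; rewrite /g (poly_module_scale (f := std_val) std_valV) /= std_val0 mulr1.
by exists g => //; apply: inj_can_sym gK std_val_inj.
Qed.

End StandardTower.

(** * The two local maps *)

Lemma local_map_mulmx (C D : bicomplex) (Y : 'M[RUV]_(rank C, rank D)) (c : int)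
    (YP : forall x, mulmxr Y (diff C x) = diff D (mulmxr Y x)) :
    (forall i j, homogR ((0, c) + gr i - gr j) (Y i j)) ->
    bijective (Htf_map U V (ChainMap YP)) ->
  local_le C D.
Proof.
move=> Yhom bijY; exists (ChainMap YP); split=> //.
by exists c => e x; apply: homogeneous_mulmx Yhom e x.
Qed.

Theorem theorem6p1 (C : bicomplex) (hC : knot_like C) :
  exists b : seq int,
    [/\ ~~ odd (size b), 0 \notin b & local_equiv C (standard_complex b)].
Proof.
have [[f [fbij fV]] _ _ _] := hC.
have [e0 [[z0 [z0c z0B]] e0_max]] := tower_max fbij fV.
have e00 := nonvbdry_deg hC z0c z0B.
have [||||b [z [c [b_even b0 [zs zB] cs zc1]]]] := @dual_strands _ (gc C) e0.
- by exists (lead (gc C) e0 z0), z0; case: z0c.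
- by move=> _ [z [ze dz zB <-]]; apply: nonvbdry_not_tors zB.
- move=> _ _ [z [ze dz zB <-]] [z' [ze' dz' zB' <-]].
  have zc : vcycle (C := C) e0 z by [].
  have zc' : vcycle (C := C) e0 z' by [].
  (* [f] sends both classes to 1, and equal classes differ by a boundary once [V = 1]. *)
  have : cls (cycU_homogenize zc) = cls (cycU_homogenize zc').
    by apply: (bij_inj fbij); rewrite !tower_cls.
  move=> /cls_eq_vbdry; rewrite (homogenizeP ze).2 (homogenizeP ze').2 => -[w zz'].
  exists w; rewrite -zz' ?leadB //.
  exact: filB.
- by move=> e z ze dz zB; apply: (nonvbdry_deg hC (z := z)).
have [_ [ze dz _ _ _]] := zs; have zc : vcycle (C := C) e0 z by [].
have [X [Xhom XA Xz]] := @strand_mx _ (cmx C) (gc C) (@cmx_hom C) (fun=> erefl)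
  _ b e0 z erefl b_even b0 zs.
have AT_hom i j : homogR (cgr (dual (gc C)) i - (1, 1) - cgr (dual (gc C)) j)
    ((cmx C)^T i j).
  by rewrite mxE /=; have := cmx_hom j i; congr homogR; bd.
have bN0 : 0 \notin map -%R b.
  apply/negP=> /mapP[x xb /eqP]; rewrite eq_sym oppr_eq0 => /eqP x0.
  by rewrite -x0 xb in b0.
have [Y [Yhom YA Yc]] := @strand_mx _ (cmx C)^T (dual (gc C)) AT_hom
  (fun s => esym (map_trmx (ev s) (cmx C))) _ (map -%R b) (- e0) c (size_map _ _)
  b_even bN0 cs.
have {}YA : cmx C *m Y^T = Y^T *m std_mx b.
  by apply: trmx_inj; rewrite !trmx_mul trmxK YA stdm_tr.
(* Both bidegrees have [gr_U] equal to 0, so the maps shift [gr_V] only. *)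
have [d dE] : exists d : int, e0 - std_gr (b := b) ord0 = (0, d).
  have := std_gr0 b; move: (std_gr (b := b) ord0) => g g0.
  by exists (e0 - g).2; bd.
have dgE (i : 'I_(size b).+1) : dg true e0 b i = (0, d) + std_gr (b := b) i.
  by rewrite -dE -(dg_std_gr e0 i) subrK.
have homz := homogenizeP ze.
have XP (x : 'rV_(rank (standard_complex b))) :
    mulmxr X (diff (standard_complex b) x) = diff C (mulmxr X x).
  by rewrite (@diffE C) /= -!mulmxA XA.
have YP (x : 'rV_(rank C)) :
    mulmxr Y^T (diff C x) = diff (standard_complex b) (mulmxr Y^T x).
  by rewrite (@diffE C) /= -!mulmxA YA.
pose u := cls (cycU_homogenize zc).
have fu : f u = 1 by apply: tower_cls.
exists b; split; [exact: b_even | exact: b0 | split].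
  apply: (@local_map_mulmx _ (standard_complex b) _ (- d) YP) => [i j|].
    rewrite mxE; have := Yhom j i; rewrite dgN dgE /=; congr homogR.
    by bd.
  apply: (poly_module_bij (f' := @std_val b) (u := u) fbij fV) => //.
  - exact: std_val_bij.
  - by move=> p h; rewrite (poly_module_scale (f := @std_val b)) //; apply: std_valV.
  (* The first row of [Y] specializes to [c], which is 1 on [z], so [u] goes to a generator. *)
  rewrite Htf_map_cls std_val_cls /=.
  suff -> : (homogenize (gc C) e0 z *m Y^T) 0 ord0 = 1 by rewrite rmorph1.
  apply: (homogR0_eq1 (s := false)).
    rewrite mxE; apply: homogR_sum => l _.
    have -> : 0 = e0 - gr l + (- e0 - cgr (dual (gc C)) l) by rewrite /=; bd.
    apply: homogRM (homz.1 l) _; rewrite mxE; have := Yhom ord0 l.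
    by rewrite dg0.
  transitivity (map_mx (ev false) (homogenize (gc C) e0 z *m Y^T) 0 ord0).
    by rewrite [RHS]mxE.
  rewrite map_mxM homz.2 -map_trmx.
  transitivity ((z *m (map_mx (ev false) (row 0 Y))^T) 0 0); last first.
    by rewrite Yc zc1 ?mxE.
  by rewrite !mxE; apply: eq_bigr => l _; rewrite !mxE.
apply: (@local_map_mulmx (standard_complex b) _ _ d XP) => [i j|].
  by have := Xhom i j; rewrite dgE.
apply: (poly_module_bij (f := @std_val b) (f' := f) (u := cls (cycU_std0 b))
  (std_val_bij b_even b0) (@std_valV b)) => //.
- by move=> p h; apply: poly_module_scale.
- exact: std_val0.
(* The first generator goes to the first row of [X], which modulo [U] is the homogenization of
   [z]. *)
rewrite Htf_map_cls -[RHS]fu; congr (f _); apply: cls_spec.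
apply/rowP=> j; rewrite /= -rowE.
have row_hom : homogR (e0 - gr j) (row ord0 X 0 j).
  by have := Xhom ord0 j; rewrite dg0 mxE.
rewrite [LHS]mxE [RHS]mxE.
apply: homogR_spec_eq row_hom (homz.1 j) _.
transitivity (map_mx (ev false) (row 0 X) 0 j); first by rewrite [RHS]mxE.
by rewrite Xz -{1}homz.2 mxE.
Qed.
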